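(* Let $\mathbb{G}$ be a stratified group with $N$ the dimension of its first stratum, and let $1<p<\infty$. Then for every complex-valued $f\in C_0^\infty(\mathbb{G}\setminus\{x'=0\})$, $$\frac{|N-p|}{p}\left\|\frac{f}{|x'|}\right\|_{L^p(\mathbb{G})}\le\|\nabla_H f\|_{L^p(\mathbb{G})},$$ and for $p\ne N$ the constant $\frac{|N-p|}{p}$ is sharp (it cannot be replaced by a larger constant for which the inequality holds for all such $f$). In particular, for $1<p<N$, $$\left\|\frac{f}{|x'|}\right\|_{L^p(\mathbb{G})}\le\frac{p}{N-p}\|\nabla_H f\|_{L^p(\mathbb{G})},$$ with $\frac{p}{N-p}$ being the best constant.
   Context: A stratified group (homogeneous Carnot group) is a Lie group $\mathbb{G}=(\mathbb{R}^n,\circ)$ such that: (a) for some natural numbers $N=N_1,N_2,\dots,N_r$ with $N_1+\dots+N_r=n$, writing $\mathbb{R}^n=\mathbb{R}^{N}\times\mathbb{R}^{N_2}\times\dots\times\mathbb{R}^{N_r}$, for every $\lambda>0$ the dilation $\delta_\lambda(x',x^{(2)},\dots,x^{(r)})=(\lambda x',\lambda^2x^{(2)},\dots,\lambda^r x^{(r)})$ is an automorphism of $\mathbb{G}$, where $x'\in\mathbb{R}^N$ and $x^{(k)}\in\mathbb{R}^{N_k}$; (b) if $X_1,\dots,X_N$ are the left-invariant vector fields on $\mathbb{G}$ with $X_k(0)=\partial/\partial x'_k|_0$, then the iterated commutators of $X_1,\dots,X_N$ span the Lie algebra of $\mathbb{G}$ (rank $n$ at every point). $N$ is the dimension of the first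 stratum. Points are written $x=(x',x'')$ with $x'\in\mathbb{R}^N$ the first-stratum variables, and $|x'|$ is the Euclidean norm on $\mathbb{R}^N$. $\nabla_H=(X_1,\dots,X_N)$ is the horizontal gradient and $|\nabla_H f|=(\sum_k|X_kf|^2)^{1/2}$. $L^p(\mathbb{G})$ is with respect to Lebesgue measure $dx$ on $\mathbb{R}^n$ (the Haar measure of $\mathbb{G}$); the $L^p$ norm of a vector-valued function is that of its Euclidean length. $C_0^\infty(U)$ denotes smooth functions with compact support in the open set $U$. *)

(* Defs.v *)
From HB Require Import structures.
From mathcomp Require Import all_boot all_order all_algebra.
From mathcomp Require Import all_classical all_reals all_analysis.
From mathcomp Require Import complex.
Set Implicit Arguments.
Unset Strict Implicit.
Unset Printing Implicit Defensive.
Import Order.TTheory GRing.Theory Num.Theory.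
Import numFieldNormedType.Exports.
Local Open Scope classical_set_scope.
Local Open Scope ring_scope.

Section LebesgueTuple.
Context (R : realType).

Notation tupR n := (n.-tuple (measurableTypeR R)).

Definition tcons n (xt : measurableTypeR R * tupR n) : tupR n.+1 :=
  [the n.+1.-tuple (measurableTypeR R) of xt.1 :: xt.2].

Lemma measurable_tcons n :
  measurable_fun [set: measurableTypeR R * tupR n] (@tcons n).
Proof. by apply: measurable_cons; [exact: measurable_fst|exact: measurable_snd]. Qed.

Definition lebesgue_cons n (m : {sigma_finite_measure set (tupR n) -> \bar R}) :
    set (tupR n.+1) -> \bar R :=
  pushforward (@lebesgue_measure R \x m)%E (@tcons n).

Section lebesgue_cons_measure.
Context (n : nat) (m : {sigma_finite_measure set (tupR n) -> \bar R}).

Let mu : {measure set (tupR n.+1) -> \bar R} :=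
  measure_function_pushforward__canonical__measure_function_Measure
    (@lebesgue_measure R \x m)%E (@measurable_tcons n).

HB.instance Definition _ := Measure.copy (lebesgue_cons m) mu.

Lemma lebesgue_consE (A : set (measurableTypeR R)) (B : set (tupR n)) :
  measurable A -> measurable B ->
  measurable [set t : tupR n.+1 | A (tnth t ord0) /\ B [tuple of behead t]] /\
  lebesgue_cons m [set t | A (tnth t ord0) /\ B [tuple of behead t]] =
    (lebesgue_measure A * m B)%E.
Proof.
move=> mA mB; split.
  apply: measurableI; rewrite -[X in measurable X]setTI.
  - exact: measurable_tnth.
  - exact: measurable_behead.
rewrite -product_measure1E// /lebesgue_cons /pushforward.
congr (product_measure1 _ _ _); apply/seteqP; split=> -[x t] /=.
- case=> Ax Bt; split=> //=.
  by rewrite (_ : t = [tuple of behead (tcons (x, t))])//; apply/val_inj.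
- case=> /= Ax Bt; split=> //; rewrite (_ : [tuple of _] = t)//.
  by apply/val_inj.
Qed.

Let lebesgue_cons_sigma_finite : sigma_finite setT (lebesgue_cons m).
Proof.
have /sigma_finiteP[F [FT ndF Foo]] := sigma_finiteT (@lebesgue_measure R).
have /sigma_finiteP[G [GT ndG Goo]] := sigma_finiteT m.
exists (fun k => [set t | F k (tnth t ord0) /\ G k [tuple of behead t]]).
  apply/seteqP; split=> // t _.
  have : [set: measurableTypeR R] (tnth t ord0) by [].
  have : [set: tupR n] [tuple of behead t] by [].
  rewrite FT GT => -[k _ Gk] [l _ Fl]; exists (maxn k l) => //; split.
  - by move: Fl; exact/subsetPset/ndF/leq_maxr.
  - by move: Gk; exact/subsetPset/ndG/leq_maxl.
move=> k; have [mF Fk] := Foo k; have [mG Gk] := Goo k.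
have [mFG ->] := lebesgue_consE mF mG; split=> //.
by rewrite lte_mul_pinfty// ge0_fin_numE.
Qed.

HB.instance Definition _ := Measure_isSigmaFinite.Build _ _ _
  (lebesgue_cons m) lebesgue_cons_sigma_finite.

End lebesgue_cons_measure.

(* Lebesgue measure on R^n, on the product sigma-algebra of n-tuples. *)
Fixpoint lebesgue_tuple n : {sigma_finite_measure set (tupR n) -> \bar R} :=
  match n with
  | 0 => dirac ([tuple] : tupR 0)
  | n'.+1 => lebesgue_cons (lebesgue_tuple n')
  end.

Lemma lebesgue_tupleE n (A : 'I_n -> set (measurableTypeR R)) :
  (forall i, measurable (A i)) ->
  lebesgue_tuple n [set t | forall i, A i (tnth t i)] =
  (\prod_(i < n) lebesgue_measure (A i))%E.
Proof.
elim: n => [|n IHn] in A * => mA /=.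
  by rewrite big_ord0 diracE mem_set// => -[].
rewrite big_ord_recl -IHn//.
have mB : measurable [set t : tupR n | forall i, A (lift ord0 i) (tnth t i)].
  rewrite (_ : [set _ | _] = \bigcap_(i in [set: 'I_n])
      ((fun t : tupR n => tnth t i) @^-1` A (lift ord0 i))); last first.
    by apply/seteqP; split=> t At i; [move=> _; exact: At|exact: (At i I)].
  apply: fin_bigcap_measurable => // i _; rewrite -[X in measurable X]setTI.
  exact: measurable_tnth.
rewrite -(lebesgue_consE (lebesgue_tuple n) (mA ord0) mB).2.
congr (_ _); apply/seteqP; split=> t /=.
  move=> At; split=> [|i]; first exact: At.
  by have := At (lift ord0 i); rewrite [in X in X -> _](tuple_eta t) tnthS.
move=> [A0 At] i; case: (unliftP ord0 i) => [j ->|->//].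
by rewrite (tuple_eta t) tnthS; exact: At.
Qed.

End LebesgueTuple.

(* On a finite-dimensional V, iterating directional derivatives in arbitrary
   fixed directions is the same as having all partial derivatives of order at
   most k exist and be continuous. *)
Fixpoint Ck (R : realType) (V W : normedModType R) (k : nat) (f : V -> W) : Prop :=
  match k with
  | 0 => continuous f
  | k'.+1 => (forall x, differentiable f x) /\ (forall v, Ck k' (fun x => 'D_v f x))
  end.

Definition smooth (R : realType) (V W : normedModType R) (f : V -> W) : Prop :=
  forall k, Ck k f.

(* The library norm on row vectors is the sup norm. *)
Definition enorm (R : realType) n (v : 'rV[R]_n) : R :=
  Num.sqrt (\sum_i v 0 i ^+ 2).

Definition cmod (R : realType) (z : R[i]) : R := ComplexField.Normc.normc z.

Definition cenorm (R : realType) n (v : 'rV[R[i]]_n) : R :=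
  Num.sqrt (\sum_i cmod (v 0 i) ^+ 2).

Section VectorFields.
Context (R : realType) (n : nat).
Notation V := 'rV[R]_n.

Definition left_invariant (mul : V -> V -> V) (X : V -> V) : Prop :=
  forall x y, 'd (mul x) y (X y) = X (mul x y).

Definition lie_bracket (X Y : V -> V) : V -> V :=
  fun x => 'D_(X x) Y x - 'D_(Y x) X x.

Inductive iterated_commutator (I : Type) (X : I -> V -> V) : (V -> V) -> Prop :=
  | IterGen k : iterated_commutator X (X k)
  | IterBracket Y Z : iterated_commutator X Y -> iterated_commutator X Z ->
      iterated_commutator X (lie_bracket Y Z).

Definition bracket_generating (I : Type) (X : I -> V -> V) : Prop :=
  forall x, exists2 Y : 'I_n -> V -> V,
    (forall i, iterated_commutator X (Y i)) & \rank (\matrix_i Y i x) = n.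

Definition vf_deriv (X : V -> V) (f : V -> R[i]) (x : V) : R[i] :=
  Complex ('D_(X x) (fun y => complex.Re (f y)) x)
          ('D_(X x) (fun y => complex.Im (f y)) x).

Definition csupport (f : V -> R[i]) : set V := closure [set x | f x != 0].

Definition test_function (U : set V) (f : V -> R[i]) : Prop :=
  [/\ smooth (fun x => complex.Re (f x)), smooth (fun x => complex.Im (f x)),
      compact (csupport f) & csupport f `<=` U].

Definition rV_of_tuple (t : n.-tuple (measurableTypeR R)) : V :=
  \row_i (tnth t i : R).

(* The L^p(R^n) norm of a function given through its modulus g. *)
Definition Lpnorm (p : R) (g : V -> R) : \bar R :=
  Lnorm (lebesgue_tuple R n) p%:E (fun t => (g (rV_of_tuple t))%:E).

End VectorFields.

(* The strata have dimensions N, N_2, ..., N_r with Ns = [:: N_2; ...; N_r], so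
   that R^n is 'rV_(N + sumn Ns), the first-stratum part of x is lsubmx x, and
   the (0-based) coordinate j lies in the stratum of 0-based index
   reshape_index (N :: Ns) j. *)
Definition dilation (R : realType) (N : nat) (Ns : seq nat) (l : R)
    (x : 'rV[R]_(N + sumn Ns)) : 'rV[R]_(N + sumn Ns) :=
  \row_j (l ^+ (reshape_index (N :: Ns) j).+1 * x 0 j).

(* The frame sg_X is determined by sg_X_left_invariant and sg_X_at0, and
   sg_dilation forces sg_one = 0. For l > 0 dilation l is bijective, so
   multiplicativity is all that being an automorphism requires. *)
Record stratifiedGroup (R : realType) (N : nat) (Ns : seq nat) := StratifiedGroup {
  sg_mul : 'rV[R]_(N + sumn Ns) -> 'rV[R]_(N + sumn Ns) -> 'rV[R]_(N + sumn Ns) ;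
  sg_one : 'rV[R]_(N + sumn Ns) ;
  sg_inv : 'rV[R]_(N + sumn Ns) -> 'rV[R]_(N + sumn Ns) ;
  sg_X : 'I_N -> 'rV[R]_(N + sumn Ns) -> 'rV[R]_(N + sumn Ns) ;
  sg_mulA : associative sg_mul ;
  sg_mul1g : left_id sg_one sg_mul ;
  sg_mulg1 : right_id sg_one sg_mul ;
  sg_mulVg : left_inverse sg_one sg_inv sg_mul ;
  sg_mulgV : right_inverse sg_one sg_inv sg_mul ;
  sg_mul_smooth : smooth
    (fun z : 'rV[R]_(N + sumn Ns) * 'rV[R]_(N + sumn Ns) => sg_mul z.1 z.2) ;
  sg_inv_smooth : smooth sg_inv ;
  sg_strata_gt0 : all (fun m => 0 < m)%N (N :: Ns) ;
  sg_dilation : forall l : R, 0 < l ->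
    {morph @dilation R N Ns l : x y / sg_mul x y} ;
  sg_X_left_invariant : forall k, left_invariant sg_mul (sg_X k) ;
  sg_X_at0 : forall k, sg_X k 0 = delta_mx 0 (lshift (sumn Ns) k) ;
  sg_hormander : bracket_generating sg_X
}.

Section Horizontal.
Context (R : realType) (N : nat) (Ns : seq nat) (G : stratifiedGroup R N Ns).
Notation V := 'rV[R]_(N + sumn Ns).

Definition hgrad (f : V -> R[i]) (x : V) : 'rV[R[i]]_N :=
  \row_k vf_deriv (sg_X G k) f x.

Definition first_stratum_neq0 : set V := [set x | lsubmx x != 0].

Definition hardy_quotient (f : V -> R[i]) (x : V) : R[i] :=
  f x / (enorm (lsubmx x))%:C%C.

End Horizontal.

(* Main.v *)
Require Import Defs.
From mathcomp Require Import all_boot all_order all_algebra.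
From mathcomp Require Import all_classical all_reals all_analysis.
From mathcomp Require Import measurable_realfun complex.
From mathcomp Require Import ring lra.
Import Order.TTheory GRing.Theory Num.Theory.
Import numFieldNormedType.Exports.
Local Open Scope classical_set_scope.
Local Open Scope ring_scope.

(** The proof rests on one structural fact. A horizontal left-invariant field is
    X_k = d/dx'_k + sum_j a_kj(x) d/dx_j with j running over the coordinates of the
    higher strata, and since dilations are automorphisms, a_kj is homogeneous of degree
    d_j - 1, where d_j is the degree of x_j. Being C^1 at the origin, it cannot depend
    on x_j. Hence X_k g integrates to 0 for every compactly supported g of class C^1
    (integral_sg_X_derive0).

    Let c = |N - p| / p and F = f / |x'|. The horizontal divergence of x' |F|^p equals
    (N - p) |F|^p plus a term bounded by p |F|^(p-1) |grad_H f|, and Young's inequality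
    yields the pointwise estimate
    c^p |F|^p - sgn(N - p) c^(p-1) div_H (x' |F|^p) <= |grad_H f|^p
    (hardy_pointwise). The divergence integrates to 0, which is the Hardy inequality
    (hardy_integral, hardy_inequality).

    For sharpness, |x'|^((p - N) / p) satisfies |grad_H f| = c |F|, but then F is
    not in L^p. It is multiplied by a cutoff of ln |x'| at scale T and by a cutoff of
    the higher strata at a homogeneous scale much larger than |x'|. The cutoffs perturb
    |grad_H f| by O(1/T) |x'|^(-N/p) on their support (near_extremal_hgrad). As
    |x'|^(-N) dx' is scale invariant, the mass of the support is at most a constant
    multiple, uniform in T, of the mass of the region where the cutoffs are bounded
    below (shell_weight_covering, near_extremal_lower). Minkowski's inequality gives
    |grad_H f| <= (c + O(1/T)) |F| in L^p norms (hardy_sharp), and T tends to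
    infinity. *)

(** * Integration over tuples *)

Section TupleIntegral.
Context {R : realType}.
Notation tupR n := (n.-tuple (measurableTypeR R)).
Local Open Scope ereal_scope.

Lemma lebesgue_tuple_integral_ge0 n (F : tupR n.+1 -> \bar R) :
  measurable_fun [set: tupR n.+1] F -> (forall t, 0 <= F t) ->
  \int[lebesgue_tuple R n.+1]_t F t =
  \int[lebesgue_measure]_x \int[lebesgue_tuple R n]_t F (tcons (x, t)).
Proof.
move=> mF F0; have mc := @measurable_tcons R n.
transitivity (\int[(lebesgue_measure \x lebesgue_tuple R n)%E]_z F (tcons z)).
  exact: (ge0_integral_pushforward mc _ measurableT mF).
apply: (fubini_tonelli1 (F \o @tcons R n)) => [|z /=]; last exact: F0.
exact: measurableT_comp.
Qed.

(** Both orders are needed: the coordinate along which a function is sliced has to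
    be integrated innermost, the coordinates in front of it outermost. *)
Lemma lebesgue_tuple_integral n (F : tupR n.+1 -> \bar R) :
  (lebesgue_tuple R n.+1).-integrable [set: tupR n.+1] F ->
  \int[lebesgue_tuple R n.+1]_t F t =
    \int[lebesgue_measure]_x \int[lebesgue_tuple R n]_t F (tcons (x, t)) /\
  \int[lebesgue_tuple R n.+1]_t F t =
    \int[lebesgue_tuple R n]_t \int[lebesgue_measure]_x F (tcons (x, t)).
Proof.
move=> iF; have mc := @measurable_tcons R n.
have mF := measurable_int _ iF.
have iFc : (lebesgue_measure \x lebesgue_tuple R n)%E.-integrable
    [set: measurableTypeR R * tupR n] (F \o @tcons R n).
  apply/integrableP; split; first exact: measurableT_comp.
  move/integrableP : (iF) => [_]; apply: le_lt_trans.
  rewrite (ge0_integral_pushforward mc (lebesgue_measure \x lebesgue_tuple R n)%E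
    measurableT (f := fun t => `|F t|))//.
  exact: measurableT_comp.
have -> : \int[lebesgue_tuple R n.+1]_t F t =
    \int[(lebesgue_measure \x lebesgue_tuple R n)%E]_z F (tcons z).
  exact: (integral_pushforward mc mF).
by split; [rewrite -(integral12_prod_meas1 iFc)|rewrite -(integral21_prod_meas1 iFc)].
Qed.

End TupleIntegral.

Section TupleScaling.
Context {R : realType}.
Notation tupR n := (n.-tuple (measurableTypeR R)).
Local Open Scope ereal_scope.

(** Lebesgue measure and l times its image under x |-> l x agree on half-open
    intervals, hence everywhere. *)
Lemma lebesgue_integral_scale (l : R) (F : measurableTypeR R -> \bar R) :
  (0 < l)%R -> measurable_fun [set: measurableTypeR R] F -> (forall x, 0 <= F x) ->
  \int[lebesgue_measure]_x F x = l%:E * \int[lebesgue_measure]_x F (l * x)%R.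
Proof.
move=> l0 mF F0; set mu := @lebesgue_measure R.
have ml : measurable_fun [set: measurableTypeR R]
   (fun x : measurableTypeR R => (l * x)%R : measurableTypeR R).
  exact: mulrl_measurable.
pose nu := mscale (NngNum (ltW l0))
  (measure_function_pushforward__canonical__measure_function_Measure mu ml).
have -> : \int[mu]_x F x = \int[nu]_x F x.
  apply: eq_measure_integral => A mA _.
  apply: lebesgue_measure_unique => // _ [[a b] _ <-].
  rewrite /nu /= /mscale /= /pushforward.
  rewrite [X in _ * lebesgue_measure X](_ : _ = `](a / l)%R, (b / l)%R]%classic); last first.
    apply/seteqP; split => x /=; rewrite !in_itv/=;
      by rewrite ltr_pdivrMr// ler_pdivlMr// ![(l * _)%R]mulrC.
  rewrite !lebesgue_measure_itv/= !lte_fin ltr_pM2r ?invr_gt0//.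
  case: ifPn => _; last by rewrite mule0.
  by rewrite -!EFinB -EFinM -mulrBl mulrC divfK// gt_eqF.
rewrite ge0_integral_mscale//; congr (_ * _).
exact: (ge0_integral_pushforward ml _ measurableT mF).
Qed.

Definition tscale n (l : 'I_n -> R) (t : tupR n) : tupR n :=
  [tuple (l i * tnth t i)%R : measurableTypeR R | i < n].

Lemma measurable_tscale n (l : 'I_n -> R) : measurable_fun [set: tupR n] (tscale n l).
Proof.
apply/measurable_fun_tnthP => i.
rewrite (_ : _ \o _ = fun t : tupR n => (l i * tnth t i)%R : measurableTypeR R); last first.
  by apply/funext => t; rewrite /= tnth_mktuple.
apply: (measurableT_comp (f := fun x : measurableTypeR R => (l i * x)%R : measurableTypeR R)).
  exact: mulrl_measurable.
exact: measurable_tnth.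
Qed.

Lemma tscale_tcons n (l : 'I_n.+1 -> R) x (t : tupR n) :
  tscale _ l (tcons (x, t)) = tcons ((l ord0 * x)%R, tscale _ (l \o lift ord0) t).
Proof.
apply: eq_from_tnth => i; rewrite tnth_mktuple.
by case: (unliftP ord0 i) => [j ->|->]; rewrite ?tnthS ?tnth_mktuple.
Qed.

(** Every coordinate has its own factor, so that x' and the higher layers can be
    rescaled independently. *)
Lemma lebesgue_tuple_scale n (l : 'I_n -> R) (F : tupR n -> \bar R) :
  (forall i, 0 < l i)%R -> measurable_fun [set: tupR n] F -> (forall t, 0 <= F t) ->
  \int[lebesgue_tuple R n]_t F t =
  (\prod_(i < n) l i)%:E * \int[lebesgue_tuple R n]_t F (tscale _ l t).
Proof.
elim: n l F => [|n IHn] l F l0 mF F0.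
  rewrite big_ord0 mul1e; apply: eq_integral => t _; congr F.
  by apply: eq_from_tnth => -[].
have mFl : measurable_fun [set: tupR n.+1] (F \o tscale _ l).
  by apply: measurableT_comp => //; exact: measurable_tscale.
have mc := @measurable_tcons R n.
have mFc : measurable_fun [set: measurableTypeR R * tupR n] (F \o @tcons R n).
  exact: measurableT_comp.
have mFx x : measurable_fun [set: tupR n] (fun t => F (tcons (x, t))).
  exact: (measurableT_comp mFc (pair1_measurable x)).
rewrite !lebesgue_tuple_integral_ge0//.
rewrite (lebesgue_integral_scale (l ord0))//; last 2 first.
- by apply: (measurable_fun_fubini_tonelli_F (F \o @tcons R n)) => // z; exact: F0.
- by move=> x; apply: integral_ge0.
rewrite big_ord_recl EFinM -muleA; congr (_ * _).
rewrite -ge0_integralZl//; last 3 first.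
- apply: (measurable_fun_fubini_tonelli_F (F \o tscale _ l \o @tcons R n)) => //.
  + exact: measurableT_comp.
  + by move=> z; exact: F0.
- by move=> x _; apply: integral_ge0 => t _; exact: F0.
- by rewrite lee_fin prodr_ge0// => i _; rewrite ltW.
apply: eq_integral => x _.
rewrite (IHn (l \o lift ord0))//; first last.
- by move=> i; exact: l0.
by congr (_ * _); apply: eq_integral => t _; rewrite tscale_tcons.
Qed.

End TupleScaling.

(** * Measurability and integration along one coordinate *)

Section ContinuousMeasurable.
Context {R : realType}.
Notation tupR n := (n.-tuple (measurableTypeR R)).

Lemma rV_norm_le n (x : 'rV[R]_n) (M : R) : 0 <= M ->
  (`|x| <= M) = [forall j, `|x 0 j| <= M].
Proof.
move=> M0; rewrite [`|x|]mx_normrE; apply/bigmax_leP/forallP.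
  by move=> [_ h] j; exact: (h (0, j)).
by move=> h; split => // -[i j] _ /=; rewrite (ord1 i).
Qed.

Lemma rV_coord_le n (x : 'rV[R]_n) j : `|x 0 j| <= `|x|.
Proof. by have := lexx `|x|; rewrite {1}rV_norm_le// => /forallP. Qed.

Let dyad k (s : R) : R := (Num.floor (s * k.+1%:R))%:~R / k.+1%:R.

Let dyad_dist k s : `|s - dyad k s| <= k.+1%:R^-1.
Proof.
have k0 : 0 < k.+1%:R :> R by rewrite ltr0n.
rewrite -(ler_pM2r k0) mulVf ?gt_eqF// -[X in _ * X](gtr0_norm k0) -normrM.
rewrite mulrBl /dyad divfK ?gt_eqF//.
have /andP[h1 h2] := floor_itv (s * k.+1%:R).
by rewrite intrD in h2; rewrite ger0_norm ?subr_ge0//; lra.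
Qed.

(** Tuples carry the product sigma-algebra. A continuous g is the pointwise limit of
    its compositions with the rounding of every coordinate down to a multiple of
    1/(k+1), and each of these is constant on countably many boxes. *)
Lemma continuous_measurable_tuple n (g : 'rV[R]_n -> R) : continuous g ->
  measurable_fun [set: tupR n] (fun t => g (rV_of_tuple t)).
Proof.
move=> cg.
pose h k (t : tupR n) : R := g (\row_i dyad k (tnth t i)).
apply: (@measurable_fun_cvg _ _ _ _ h).
- move=> k _ Y mY; rewrite setTI.
  have -> : h k @^-1` Y = \bigcup_(z : n.-tuple int)
      [set t | Y (g (\row_i ((tnth z i)%:~R / k.+1%:R))) /\
         forall i, Num.floor (tnth t i * k.+1%:R) = tnth z i].
    apply/seteqP; split => t /=.
      move=> Yt; exists [tuple Num.floor (tnth t i * k.+1%:R) | i < n] => //=.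
      split; last by move=> i; rewrite tnth_mktuple.
      by rewrite (_ : (\row_i _) = \row_i dyad k (tnth t i))//;
        apply/rowP => i; rewrite !mxE tnth_mktuple.
    move=> [z _ /= [Yz tz]]; rewrite /h.
    by rewrite (_ : (\row_i _) = \row_i ((tnth z i)%:~R / k.+1%:R))//;
      apply/rowP => i; rewrite !mxE /dyad tz.
  apply: countable_bigcupT_measurable => // z.
  have [Yz|nYz] := pselect (Y (g (\row_i ((tnth z i)%:~R / k.+1%:R)))); last first.
    by rewrite (_ : [set t | _] = set0)//; apply/seteqP; split => t // [].
  rewrite (_ : [set t | _] = \bigcap_(i in [set: 'I_n])
      ((fun t : tupR n => tnth t i) @^-1`
        `[(tnth z i)%:~R / k.+1%:R, (tnth z i + 1)%:~R / k.+1%:R[%classic)).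
    apply: fin_bigcap_measurable => // i _; rewrite -[X in measurable X]setTI.
    exact: (measurable_tnth i).
  apply/seteqP; split => t /=.
    move=> [_ tz] i _ /=; rewrite in_itv/= ler_pdivrMr ?ltr0n// ltr_pdivlMr ?ltr0n//.
    by rewrite -tz floor_itv.
  move=> tz; split => // i; apply: floor_def.
  by have := tz i I; rewrite /= in_itv/= ler_pdivrMr ?ltr0n// ltr_pdivlMr ?ltr0n//.
- move=> t _; rewrite /h.
  apply: (@cvg_comp _ _ _ (fun k => \row_i dyad k (tnth t i)) g _ (nbhs (rV_of_tuple t))).
    apply/cvgrPdist_le => e e0; near=> k.
    rewrite rV_norm_le ?ltW//; apply/forallP => i; rewrite !mxE.
    apply: (le_trans (dyad_dist k _)); apply: ltW; near: k.
    exact: (near_infty_natSinv_lt (PosNum e0)).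
  exact: cg.
Unshelve. all: by end_near. Qed.

End ContinuousMeasurable.

Section BoxSupport.
Context {R : realType}.
Notation tupR n := (n.-tuple (measurableTypeR R)).

(** One constant bounds the function and its support, so that every slice inherits
    the property and no slice has to be excluded for lack of integrability. *)
Definition box_supported n (K : R) (H : tupR n -> R) : Prop :=
  measurable_fun [set: tupR n] H /\
  forall t, `|H t| <= K /\ (H t != 0 -> forall i, `|tnth t i| <= K).

Lemma measurable_box n (K : R) :
  measurable [set t : tupR n | forall i, `|tnth t i| <= K].
Proof.
rewrite (_ : [set t | _] = \bigcap_(i in [set: 'I_n])
   (fun t : tupR n => (`|tnth t i| <= K)) @^-1` [set true]); last first.
  by apply/seteqP; split => t /= h i; [move=> _; exact/h|exact: (h i I)].
apply: fin_bigcap_measurable => // i _; rewrite -[X in measurable X]setTI.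
apply: measurable_fun_ler => //; apply: measurableT_comp => //.
exact: measurable_tnth.
Qed.

Lemma box_supported_integrable n K (H : tupR n -> R) : box_supported n K H ->
  (lebesgue_tuple R n).-integrable [set: tupR n] (EFin \o H).
Proof.
move=> [mH KH].
pose B := [set t : tupR n | forall i, `|tnth t i| <= K].
have mB : measurable B by exact: measurable_box.
have -> : EFin \o H = (EFin \o H) \_ B.
  apply/funext => t; rewrite patchE; case: ifPn => //.
  rewrite notin_setE => Bt; apply/eqP/negPn/negP; rewrite eqe => H0.
  by apply: Bt; exact: (KH t).2.
apply/(integrable_mkcond _ mB).
apply: measurable_bounded_integrable => //.
- pose I : set (measurableTypeR R) := `[-K, K]%classic.
  have mI : measurable I by exact: measurable_itv.
  have BE : lebesgue_tuple R n B = (\prod_(i < n) lebesgue_measure I)%E.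
    rewrite -(lebesgue_tupleE (A := fun _ => I))//.
    congr (lebesgue_tuple R n _).
    by apply/seteqP; split => t /= h i; have := h i; rewrite /I/= in_itv/= ler_norml.
  have : (\prod_(i < n) lebesgue_measure I)%E \is a fin_num.
    elim/big_ind : _ => // [x y|i _]; first exact: fin_numM.
    by rewrite lebesgue_measure_itv/=; case: ifP.
  by rewrite -BE fin_numElt => /andP[].
- exact: measurable_funS mH.
- exists K; split; first exact: num_real.
  by move=> M KM t _; exact: (le_trans (KH t).1 (ltW KM)).
Qed.

Definition set_tnth n (t : tupR n) (j : 'I_n) (s : R) : tupR n :=
  [tuple if i == j then s : measurableTypeR R else tnth t i | i < n].

Lemma box_supported_tcons n K (H : tupR n.+1 -> R) x : box_supported n.+1 K H ->
  box_supported n K (fun t => H (tcons (x, t))).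
Proof.
move=> [mH KH]; split.
  apply: (measurableT_comp (f := H \o @tcons R n)) => //.
  by apply: measurableT_comp => //; exact: measurable_tcons.
move=> t; split; first exact: (KH _).1.
by move=> /(KH _).2 h i; have := h (lift ord0 i); rewrite tnthS.
Qed.

Lemma set_tnth_tcons0 n x y (t : tupR n) :
  set_tnth n.+1 (tcons (x, t)) ord0 y = tcons (y, t).
Proof.
apply: eq_from_tnth => i; rewrite tnth_mktuple.
by case: (unliftP ord0 i) => [j ->|->]//=; rewrite !tnthS.
Qed.

Lemma set_tnth_tconsS n x y (t : tupR n) j :
  set_tnth n.+1 (tcons (x, t)) (lift ord0 j) y = tcons (x, set_tnth n t j y).
Proof.
apply: eq_from_tnth => i; rewrite tnth_mktuple.
case: (unliftP ord0 i) => [k ->|->]//=; rewrite !tnthS tnth_mktuple.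
by rewrite (inj_eq lift_inj).
Qed.

(** Fubini's theorem, peeling off the coordinates in front of j one at a time. *)
Lemma integral_slice0 n j K (H : tupR n -> R) : box_supported n K H ->
  (forall t, \int[lebesgue_measure]_s (H (set_tnth n t j s))%:E = 0)%E ->
  (\int[lebesgue_tuple R n]_t (H t)%:E = 0)%E.
Proof.
elim: n j H => [[]//|n IHn] j H KH H0.
have [h1 h2] := lebesgue_tuple_integral _ _ (box_supported_integrable _ _ _ KH).
case: (unliftP ord0 j) H0 => [k ->|->] H0.
  rewrite h1 integral0_eq// => x _.
  apply: (IHn k) => [|t]; first exact: box_supported_tcons.
  by rewrite -[RHS](H0 (tcons (x, t))); apply: eq_integral => s _; rewrite set_tnth_tconsS.
rewrite h2 integral0_eq// => t _.
by rewrite -[RHS](H0 (tcons (0, t))); apply: eq_integral => s _; rewrite set_tnth_tcons0.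
Qed.

End BoxSupport.

(** * Differential calculus and closure properties of Ck *)

Section Calculus.
Context {R : realType}.

Lemma derive_comp1 (V : normedModType R) (f : V -> R) (phi : R -> R) x v a :
  differentiable f x -> is_derive (f x) 1 phi a ->
  differentiable (phi \o f) x /\ 'D_v (phi \o f) x = a * 'D_v f x.
Proof.
move=> df dphi.
have dphi' : differentiable phi (f x) by apply/derivable1_diffP; exact: ex_derive.
split; first exact: differentiable_comp.
rewrite !deriveE//; last exact: differentiable_comp.
rewrite diff_comp//= diff1E// derive1E (derive_val (f := phi)).
by rewrite [_ *: _]mulrC.
Qed.

Lemma differentiable_rV_coord n (x : 'rV[R]_n) j :
  differentiable (fun y : 'rV[R]_n => y 0 j : R) x.
Proof. exact: differentiable_coord. Qed.

Lemma derive_rV_coord n (x v : 'rV[R]_n) j :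
  'D_v (fun y : 'rV[R]_n => y 0 j : R) x = v 0 j.
Proof.
apply: derive_val.
have h : (fun h : R => h^-1 *: ((h *: v + x) 0 j - x 0 j)) @ 0^' --> v 0 j.
  apply: cvg_near_cst; near=> h; rewrite !mxE addrK scalerA mulVf ?scale1r//.
  by near: h; exact: nbhs_dnbhs_neq.
by apply: DeriveDef; [apply/cvg_ex; eexists; exact: h|exact/cvg_lim].
Unshelve. all: by end_near. Qed.

Lemma is_derive_line (V : normedModType R) (f : V -> R) x v t :
  differentiable f (x + t *: v) ->
  is_derive t 1 (fun s : R => f (x + s *: v)) ('D_v f (x + t *: v)).
Proof.
move=> df.
have dl : is_diff t (fun s : R => x + s *: v) (fun s => s *: v).
  have := is_diffD (is_diff_cst x t) (is_diff_scalel t v).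
  by rewrite add0r.
have dfl : differentiable (fun s : R => f (x + s *: v)) t.
  exact: (differentiable_comp (f := fun s : R => x + s *: v) (g := f)).
apply: DeriveDef; first exact/derivable1_diffP.
rewrite deriveE// (diff_comp (f := fun s : R => x + s *: v) (g := f))//=.
by rewrite (diff_val (f := fun s : R => x + s *: v)) scale1r -deriveE.
Qed.

Lemma derive_near0 (V : normedModType R) (f : V -> R) x v :
  (\forall y \near x, f y = 0) -> 'D_v f x = 0.
Proof.
move=> f0; rewrite (near_eq_derive v (g := cst 0))//.
exact: derive_cst.
Qed.

Lemma derive_sum_coord n (f : 'rV[R]_n -> R) (x v : 'rV[R]_n) : differentiable f x ->
  'D_v f x = \sum_j v 0 j * 'D_(delta_mx 0 j) f x.
Proof.
move=> df; rewrite deriveE// {1}(row_sum_delta v) linear_sum.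
by apply: eq_bigr => j _; rewrite linearZ deriveE.
Qed.

End Calculus.

Section CkClosure.
Context {R : realType} {V : normedModType R}.
Implicit Types f g : V -> R.

Lemma Ck_ext k f g : f =1 g -> Ck k f -> Ck k g.
Proof. by move=> /funext ->. Qed.

Lemma Ck_continuous k f : Ck k f -> continuous f.
Proof.
case: k => [//|k [df _]] x; exact/differentiable_continuous.
Qed.

Lemma CkS k f : Ck k.+1 f -> Ck k f.
Proof.
elim: k f => [|k IHk] f; first by move=> /Ck_continuous.
by move=> [df Df]; split => // v; exact/IHk/Df.
Qed.

Lemma Ck_cst k (c : R) : Ck k (fun _ : V => c).
Proof.
elim: k c => [|k IHk] c; first exact: cst_continuous.
split=> [x|v]; first exact: differentiable_cst.
by apply: Ck_ext (IHk 0) => x; rewrite (derive_cst c).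
Qed.

Lemma CkD k f g : Ck k f -> Ck k g -> Ck k (fun x => f x + g x).
Proof.
elim: k f g => [|k IHk] f g; first by move=> cf cg x; apply: cvgD; [exact: cf|exact: cg].
move=> [df Df] [dg Dg]; split=> [x|v]; first exact: differentiableD.
apply: Ck_ext (IHk _ _ (Df v) (Dg v)) => x.
by rewrite [RHS]deriveD//; exact: diff_derivable.
Qed.

(** Leibniz' rule by induction on the order; the factor that is not differentiated
    keeps one order to spare. *)
Lemma CkM k f g : Ck k f -> Ck k g -> Ck k (fun x => f x * g x).
Proof.
elim: k f g => [|k IHk] f g; first by move=> cf cg x; apply: cvgM; [exact: cf|exact: cg].
move=> hf hg; have [df Df] := hf; have [dg Dg] := hg.
split=> [x|v]; first exact: differentiableM.
apply: Ck_ext (CkD k _ _ (IHk _ _ (CkS _ _ hf) (Dg v)) (IHk _ _ (CkS _ _ hg) (Df v))) => x.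
by rewrite [RHS]deriveM//; exact: diff_derivable.
Qed.

Lemma Ck_sum (I : Type) (r : seq I) k (F : I -> V -> R) : (forall i, Ck k (F i)) ->
  Ck k (fun x => \sum_(i <- r) F i x).
Proof.
move=> h; elim: r => [|i r IHr].
  by apply: Ck_ext (Ck_cst k 0) => x; rewrite big_nil.
by apply: Ck_ext (CkD _ _ _ (h i) IHr) => x; rewrite big_cons.
Qed.

Lemma Ck_prod (I : Type) (r : seq I) k (F : I -> V -> R) : (forall i, Ck k (F i)) ->
  Ck k (fun x => \prod_(i <- r) F i x).
Proof.
move=> h; elim: r => [|i r IHr].
  by apply: Ck_ext (Ck_cst k 1) => x; rewrite big_nil.
by apply: Ck_ext (CkM _ _ _ (h i) IHr) => x; rewrite big_cons.
Qed.

Lemma Ck_comp k (phi : R -> R) f : Ck k phi -> Ck k f -> Ck k (phi \o f).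
Proof.
elim: k phi f => [|k IHk] phi f.
  by move=> cphi cf x; apply: continuous_comp; [exact: cf|exact: cphi].
move=> [dphi Dphi] hf; have [df Df] := hf.
have D x : is_derive (f x) 1 phi ('D_1 phi (f x)).
  by apply/derivableP/derivable1_diffP.
split=> [x|v]; first by have [] := derive_comp1 _ f phi x 0 _ (df x) (D x).
apply: Ck_ext (CkM _ _ _ (IHk _ _ (Dphi 1) (CkS _ _ hf)) (Df v)) => x.
by have [_ ->] := derive_comp1 _ f phi x v _ (df x) (D x).
Qed.

End CkClosure.

Lemma Ck_coord (R : realType) n k j : Ck k (fun x : 'rV[R]_n => x 0 j : R).
Proof.
case: k => [|k]; first by move=> x; exact: coord_continuous.
split=> [x|v]; first exact: differentiable_rV_coord.
by apply: Ck_ext (Ck_cst k (v 0 j)) => x; rewrite derive_rV_coord.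
Qed.

(** On the line every directional derivative is a multiple of the derivative. *)
Lemma Ck_derive1 (R : realType) (k : nat) (phi dphi : R -> R) :
  (forall s : R, is_derive s (1 : R) phi (dphi s)) -> Ck k dphi -> Ck k.+1 phi.
Proof.
move=> D hd; split=> [s|v]; first by apply/derivable1_diffP; exact: ex_derive.
apply: Ck_ext (CkM _ _ _ (Ck_cst k v) hd) => s.
have ds : differentiable phi s by apply/derivable1_diffP; exact: ex_derive.
by rewrite deriveE// diff1E// derive1E (derive_val (f := phi)).
Qed.

Section IntegralDerivative.
Context {R : realType}.

Lemma integral_derivative0 (phi dphi : R -> R) (K : R) :
  (forall s : R, is_derive s (1 : R) phi (dphi s)) -> continuous dphi ->
  (forall s, phi s != 0 -> `|s| <= K) ->
  (\int[lebesgue_measure]_s (dphi s)%:E = 0)%E.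
Proof.
move=> D cd K0.
have phi0 s : `|K| < `|s| -> phi s = 0.
  move=> Ks; apply/eqP/negPn/negP => /K0 sK.
  by have := lt_le_trans Ks (le_trans sK (ler_norm K)); rewrite ltxx.
have dphi0 s : `|K| < `|s| -> dphi s = 0.
  move=> Ks; rewrite -(@derive_val _ _ _ s 1 phi _ (D s)); apply: derive_near0.
  near=> y; apply: phi0; near: y.
  have cn : {for s, continuous (fun y : R => `|y|)} by exact: norm_continuous.
  exact: (cvgr_gt _ cn).
pose L := `|K| + 1.
have L0 : 0 < L by rewrite /L ltr_wpDl.
have -> : (\int[lebesgue_measure]_s (dphi s)%:E =
    \int[lebesgue_measure]_(s in `[(- L)%R, L]) (dphi s)%:E)%E.
  rewrite [RHS]integral_mkcond; apply: eq_integral => s _.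
  rewrite patchE; case: ifPn => //; rewrite notin_setE /= in_itv/= => /negP.
  rewrite -ler_norml -ltNge => h; rewrite dphi0//.
  by apply: le_lt_trans h; rewrite /L lerDl.
have cphi : continuous phi.
  by move=> s; apply/differentiable_continuous/derivable1_diffP; exact: ex_derive.
rewrite (@continuous_FTC2 _ dphi phi).
- have KL : `|K| < `|L| by rewrite (gtr0_norm L0) ltrDl.
  by rewrite !phi0 ?normrN// subee.
- by rewrite gtrN.
- exact: continuous_subspaceT.
- split => [s _||]; first exact: ex_derive.
  + by apply: cvg_at_right_filter; exact: cphi.
  + by apply: cvg_at_left_filter; exact: cphi.
- by move=> s _; rewrite derive1E (derive_val (f := phi)).
Unshelve. all: by end_near. Qed.

End IntegralDerivative.

Lemma derive_coord_comp (R : realType) (U : normedModType R) n (F : U -> 'rV[R]_n) j u v :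
  differentiable F u ->
  differentiable (fun w => F w 0 j : R) u /\
  'D_v (fun w => F w 0 j : R) u = ('D_v F u) 0 j.
Proof.
move=> dF.
have dc := differentiable_rV_coord n (F u) j.
have dcomp : differentiable (fun w => F w 0 j : R) u.
  exact: (differentiable_comp (g := fun y : 'rV[R]_n => y 0 j : R)).
split=> //; rewrite !deriveE//.
rewrite (diff_comp (f := F) (g := fun y : 'rV[R]_n => y 0 j : R))//=.
by rewrite -[LHS]deriveE// derive_rV_coord.
Qed.

(** * The horizontal frame and its divergence *)

Section Frame.
Context {R : realType} {N : nat} {Ns : seq nat} (G : stratifiedGroup R N Ns).
Notation V := 'rV[R]_(N + sumn Ns).
Notation dil := (@dilation R N Ns).
Notation stratum j := (reshape_index (N :: Ns) j).

Lemma stratum_lshift (k : 'I_N) : stratum (lshift (sumn Ns) k) = 0%N.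
Proof. have /eqP h : (k.+1 - N == 0)%N by rewrite subn_eq0.
by rewrite /reshape_index/= h. Qed.

(** Dilations fix the neutral element, and 0 is the only point fixed by all of
    them. *)
Lemma sg_one0 : sg_one G = 0.
Proof.
have two0 : 0 < 2 :> R by [].
have u1 : dil 2 (sg_one G) = sg_one G.
  set u := dil 2 _.
  have uu : sg_mul G u u = u by rewrite -sg_dilation// sg_mul1g.
  by rewrite -[LHS](sg_mul1g G) -(sg_mulVg G u) -sg_mulA uu.
apply/rowP => j; have := congr1 (fun v : V => v 0 j) u1; rewrite !mxE => /eqP.
rewrite -subr_eq0 -[X in _ - X]mul1r -mulrBl mulf_eq0 subr_eq0 gt_eqF/=.
  by move/eqP.
by rewrite exprn_egt1// ltr1n.
Qed.

Lemma dilation_delta l (t : R) (k : 'I_N) :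
  dil l (t *: delta_mx 0 (lshift (sumn Ns) k)) =
  (l * t) *: delta_mx 0 (lshift (sumn Ns) k).
Proof.
apply/rowP => j; rewrite !mxE/=; have [->|] := eqVneq j (lshift (sumn Ns) k).
  by rewrite stratum_lshift expr1 ?eqxx mulrA.
by rewrite ?andbF !mulr0.
Qed.

Lemma dilation_cvg0 (x : V) : dil m.+1%:R^-1 x @[m --> \oo] --> (0 : V).
Proof.
apply/cvgrPdist_le => e e0; near=> m.
rewrite sub0r normrN; apply: (@le_trans _ _ (m.+1%:R^-1 * `|x|)).
  rewrite rV_norm_le ?mulr_ge0//; apply/forallP => j.
  rewrite mxE exprS -mulrA normrM ger0_norm// ler_wpM2l//.
  rewrite normrM; apply: le_trans (rV_coord_le _ x j).
  rewrite ler_piMl// normrX ger0_norm// exprn_ile1//.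
  by rewrite invf_le1// ler1n.
apply: (@le_trans _ _ (m.+1%:R^-1 * (`|x| + 1))); first by rewrite ler_wpM2l// lerDl.
rewrite -ler_pdivlMr ?ltr_wpDl//; apply: ltW; near: m.
have ex : 0 < e / (`|x| + 1) by rewrite divr_gt0// ltr_wpDl.
exact: (near_infty_natSinv_lt (PosNum ex)).
Unshelve. all: by end_near. Qed.

Let M (z : V * V) : V := sg_mul G z.1 z.2.

Let differentiable_M z : differentiable M z.
Proof. exact: (sg_mul_smooth G 1%N).1. Qed.

Let pair_diff (x y : V) : is_diff y (fun y : V => (x, y)) (fun v : V => (0 : V, v)).
Proof. exact: (is_diff_pair (is_diff_cst x y) (is_diff_id y)). Qed.

Let pairl_diff (x y : V) : is_diff x (fun x : V => (x, y)) (fun v : V => (v, 0 : V)).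
Proof. exact: (is_diff_pair (is_diff_id x) (is_diff_cst y x)). Qed.

Let e k : V := delta_mx 0 (lshift (sumn Ns) k).

Let differentiable_mul x y : differentiable (sg_mul G x) y.
Proof. by apply: (differentiable_comp (f := fun y : V => (x, y)) (g := M)). Qed.

Let sg_XE k x : sg_X G k x = 'd (sg_mul G x) 0 (e k).
Proof.
have x0 : sg_mul G x 0 = x by rewrite -sg_one0 sg_mulg1.
by rewrite /e -(sg_X_at0 G k) sg_X_left_invariant x0.
Qed.

Let sg_XDE k x : sg_X G k x = 'D_(0, e k) M (x, 0).
Proof.
rewrite sg_XE deriveE// (diff_comp (f := fun y : V => (x, y)) (g := M))//=.
by rewrite (diff_val (f := fun y : V => (x, y))).
Qed.

(** By left invariance X_k(x) is the derivative of the group law at (x, 0) in the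
    direction (0, e_k), and so inherits its regularity from the law. *)
Lemma sg_X_C1 k j : Ck 1 (fun x : V => sg_X G k x 0 j : R).
Proof.
have [_ /(_ (0, e k))] := sg_mul_smooth G 2%N.
rewrite -/M => -[dQ cQ].
have dX x : differentiable (sg_X G k) x.
  rewrite (_ : sg_X G k = fun x => 'D_(0, e k) M (x, 0)); last first.
    by apply/funext => y; exact: sg_XDE.
  exact: (differentiable_comp (f := fun x : V => (x, 0 : V)) (g := fun z => 'D_(0, e k) M z)).
split=> [x|v]; first by have [] := derive_coord_comp _ _ _ _ j x 0 (dX x).
have -> : (fun x => 'D_v (fun x : V => sg_X G k x 0 j : R) x) =
    fun x : V => ('D_(v, 0) (fun z => 'D_(0, e k) M z) (x, 0 : V)) 0 j.
  apply/funext => x; have [_ ->] := derive_coord_comp _ _ _ _ j x v (dX x).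
  congr (_ _ _); rewrite !deriveE//.
  rewrite (_ : sg_X G k = (fun z => 'D_(0, e k) M z) \o (fun x : V => (x, 0 : V))); last first.
    by apply/funext => y; exact: sg_XDE.
  by rewrite diff_comp//= (diff_val (f := fun x : V => (x, 0 : V))).
move=> x.
apply: (@continuous_comp _ _ _ (fun x : V => (x, 0 : V))
  (fun z => ('D_(v, 0) (fun z => 'D_(0, e k) M z) z) 0 j : R)).
  exact: differentiable_continuous.
apply: (@continuous_comp _ _ _ (fun z => 'D_(v, 0) (fun z => 'D_(0, e k) M z) z)
  (fun y : V => y 0 j : R)); first exact: cQ.
exact: coord_continuous.
Qed.

(** Differentiate the identity delta_l (x o t e_k) = delta_l x o (l t) e_k at t = 0. *)
Lemma sg_X_homogeneous k l x j : 0 < l ->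
  sg_X G k (dil l x) 0 j = l ^+ (stratum j) * sg_X G k x 0 j.
Proof.
move=> l0; apply: (mulfI (lt0r_neq0 l0)); rewrite mulrA -exprS.
pose phi y (t : R) : R := sg_mul G y (t *: e k) 0 j.
have D y : is_derive (0 : R) (1 : R) (phi y) (sg_X G k y 0 j).
  have [dm Dm] := derive_coord_comp _ _ _ _ j 0 (e k) (differentiable_mul y 0).
  have := is_derive_line _ (fun z => sg_mul G y z 0 j) 0 (e k) 0.
  rewrite scale0r addr0 Dm deriveE// -sg_XE => /(_ dm).
  by rewrite (_ : (fun s : R => _) = phi y)//; apply/funext => t; rewrite add0r.
have E : phi (dil l x) \o (fun t => l * t) = (fun t => l ^+ (stratum j).+1 * phi x t).
  apply/funext => t /=; rewrite /phi -dilation_delta -sg_dilation//.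
  by rewrite mxE.
have D1 : is_derive (0 : R) (1 : R) (phi (dil l x) \o (fun t => l * t))
    (sg_X G k (dil l x) 0 j * (l *: 1)).
  apply: is_derive1_comp; rewrite ?mulr0; first exact: D.
have D2 : is_derive (0 : R) (1 : R) (phi (dil l x) \o (fun t => l * t))
    (l ^+ (stratum j).+1 *: sg_X G k x 0 j).
  by rewrite E; apply: is_deriveZ.
have := @derive_val _ _ _ _ _ _ _ D1.
by rewrite (@derive_val _ _ _ _ _ _ _ D2) /GRing.scale/= mulr1 [RHS]mulrC => ->.
Qed.

End Frame.

Section Divergence.
Context {R : realType} {N : nat} {Ns : seq nat} (G : stratifiedGroup R N Ns).
Notation V := 'rV[R]_(N + sumn Ns).
Notation dil := (@dilation R N Ns).
Notation stratum j := (reshape_index (N :: Ns) j).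

(** A continuous function that is homogeneous of degree 0 equals its value at the
    origin. *)
Lemma sg_X_first_stratum k i x :
  sg_X G k x 0 (lshift (sumn Ns) i) = (i == k)%:R.
Proof.
have cX : continuous (fun x : V => sg_X G k x 0 (lshift (sumn Ns) i) : R).
  exact: (Ck_continuous 1%N _ (sg_X_C1 G k _)).
have h1 : sg_X G k (dil m.+1%:R^-1 x) 0 (lshift (sumn Ns) i) @[m --> \oo] -->
    sg_X G k 0 0 (lshift (sumn Ns) i).
  exact: (cvg_comp _ _ (dilation_cvg0 x) (cX 0)).
have h2 : sg_X G k (dil m.+1%:R^-1 x) 0 (lshift (sumn Ns) i) @[m --> \oo] -->
    sg_X G k x 0 (lshift (sumn Ns) i).
  apply: cvg_near_cst; near=> m.
  by rewrite sg_X_homogeneous// stratum_lshift expr0 mul1r.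
have := cvg_unique _ h2 h1; rewrite sg_X_at0 => ->//.
by rewrite mxE eqxx/= (inj_eq (@lshift_inj _ _)).
Unshelve. all: by end_near. Qed.

Lemma dilationD_delta l (t : R) x j :
  dil l (x + t *: delta_mx 0 j) =
  dil l x + (l ^+ (stratum j).+1 * t) *: delta_mx 0 j.
Proof.
apply/rowP => i; rewrite !mxE/= mulrDr; congr (_ + _).
by have [->|] := eqVneq i j; rewrite ?eqxx ?mulrA// ?andbF !mulr0.
Qed.

(** The derivative in x_j of the j-th coefficient is homogeneous of degree -1 and
    continuous at the origin, which forces it to vanish. *)
Let derive_coef0 k j x :
  'D_(delta_mx 0 j) (fun x : V => sg_X G k x 0 j : R) x = 0.
Proof.
pose a (x : V) : R := sg_X G k x 0 j.
have [da Da] := sg_X_C1 G k j.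
rewrite -/a; set b := fun x => 'D_(delta_mx 0 j) a x.
have bE l y : 0 < l -> b y = l * b (dil l y).
  move=> l0; have ln0 := lt0r_neq0 l0.
  have D z := is_derive_line _ a z (delta_mx 0 j) 0 (da _).
  have D1 : is_derive (0 : R) (1 : R)
     ((fun s => a (dil l y + s *: delta_mx 0 j)) \o
       (fun t => l ^+ (stratum j).+1 * t))
     (b (dil l y) * (l ^+ (stratum j).+1 *: 1)).
    apply: is_derive1_comp; rewrite mulr0.
    by have := D (dil l y); rewrite scale0r addr0.
  have D2 : is_derive (0 : R) (1 : R)
     ((fun s => a (dil l y + s *: delta_mx 0 j)) \o
       (fun t => l ^+ (stratum j).+1 * t)) (l ^+ (stratum j) *: b y).
    rewrite (_ : _ \o _ = l ^+ (stratum j) *: (fun s => a (y + s *: delta_mx 0 j))).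
      by apply: is_deriveZ; have := D y; rewrite scale0r addr0.
    apply/funext => t /=; rewrite -dilationD_delta /a sg_X_homogeneous//.
  apply: (mulfI (expf_neq0 (stratum j) ln0)).
  have := @derive_val _ _ _ _ _ _ _ D1; rewrite (@derive_val _ _ _ _ _ _ _ D2).
  rewrite /GRing.scale/= mulr1 => ->.
  by rewrite mulrC exprS mulrA [_ * l]mulrC.
have h1 : m.+1%:R^-1 * b (dil m.+1%:R^-1 x) @[m --> \oo] --> (0 * b 0 : R).
  apply: cvgM; first exact: cvg_harmonic.
  exact: (cvg_comp _ _ (dilation_cvg0 x) (Da _ 0)).
have h2 : m.+1%:R^-1 * b (dil m.+1%:R^-1 x) @[m --> \oo] --> b x.
  by apply: cvg_near_cst; near=> m; rewrite -bE.
by rewrite -/(b x) (cvg_unique _ h2 h1)// mul0r.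
Unshelve. all: by end_near. Qed.

Lemma sg_X_coord_indep k j x s :
  sg_X G k (x + s *: delta_mx 0 j) 0 j = sg_X G k x 0 j.
Proof.
have [da _] := sg_X_C1 G k j.
rewrite -[in RHS](addr0 x) -(scale0r (delta_mx 0 j)).
apply: (is_derive_0_is_cst (f := fun s => sg_X G k (x + s *: delta_mx 0 j) 0 j : R)).
move=> t; have := is_derive_line _ _ x (delta_mx 0 j) t (da _).
by rewrite derive_coef0.
Qed.

Lemma continuous_sg_X_derive k (f : V -> R) : Ck 1 f ->
  continuous (fun x => 'D_(sg_X G k x) f x).
Proof.
move=> [df Df].
have -> : (fun x => 'D_(sg_X G k x) f x) =
    (fun x => \sum_j sg_X G k x 0 j * 'D_(delta_mx 0 j) f x).
  by apply/funext => y; rewrite derive_sum_coord.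
have c : Ck 0 (fun x => \sum_j sg_X G k x 0 j * 'D_(delta_mx 0 j) f x).
  apply: Ck_sum => j; apply: (CkM 0%N); last exact: Df.
  exact: (CkS 0%N _ (sg_X_C1 G k j)).
exact: c.
Qed.

Lemma rV_set_tnth n (t : n.-tuple (measurableTypeR R)) j s :
  rV_of_tuple (set_tnth n t j s) =
  rV_of_tuple (set_tnth n t j 0) + s *: delta_mx 0 j.
Proof.
apply/rowP => i; rewrite !mxE !tnth_mktuple/=.
by case: (eqVneq i j) => [e|_]; rewrite ?e ?mulr1 ?add0r// mulr0 addr0.
Qed.

Lemma continuous_box_supported n (g : 'rV[R]_n -> R) (K : R) : continuous g ->
  (forall x, g x != 0 -> `|x| <= K) ->
  exists K', box_supported n K' (fun t => g (rV_of_tuple t)).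
Proof.
move=> cg gK.
have cB : compact [set x : 'rV[R]_n | `|x| <= K].
  apply: bounded_closed_compact.
    by exists K; split; [exact: num_real|move=> M KM x /= /le_trans; apply; exact: ltW].
  apply: (@closed_comp _ _ (fun x : 'rV[R]_n => `|x|) [set y | y <= K]) => //.
  by move=> x _; exact: norm_continuous.
have [M [_ gM]] : bounded_set [set g x | x in [set x : 'rV[R]_n | `|x| <= K]].
  by apply/compact_bounded/continuous_compact => //; exact: continuous_subspaceT.
exists (Num.max K (`|M| + 1)); split; first exact: continuous_measurable_tuple.
move=> t; split.
  have [g0|/gK h] := eqVneq (g (rV_of_tuple t)) 0.
    by rewrite g0 normr0 le_max orbC addr_ge0.
  rewrite le_max; apply/orP; right; apply: gM; last by exists (rV_of_tuple t).
  by rewrite ltr_pwDr// ler_norm.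
move=> /gK tK i; rewrite le_max; apply/orP; left; apply: le_trans tK.
by have := rV_coord_le _ (rV_of_tuple t) i; rewrite mxE.
Qed.

Lemma derive_supp (W : normedModType R) (g : W -> R) (K : R) v x : continuous g ->
  (forall x, g x != 0 -> `|x| <= K) -> 'D_v g x != 0 -> `|x| <= K.
Proof.
move=> cg gK; apply: contraNT; rewrite -ltNge => Kx; apply/eqP/derive_near0.
near=> y; apply/eqP/negPn/negP => /gK; apply/negP; rewrite -ltNge; near: y.
have cn : {for x, continuous (fun y : W => `|y|)} by exact: norm_continuous.
exact: (cvgr_gt _ cn).
Unshelve. all: by end_near. Qed.

(** Horizontal fields are divergence free in the strongest sense: in
    X_k = sum_j a_kj d/dx_j the coefficient a_kj is constant along the j-th coordinate
    lines, so each term of X_k g integrates to 0 along its own lines. *)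
Lemma integral_sg_X_derive0 k (g : V -> R) (K : R) : Ck 1 g ->
  (forall x, g x != 0 -> `|x| <= K) ->
  let H t := 'D_(sg_X G k (rV_of_tuple t)) g (rV_of_tuple t) in
  (lebesgue_tuple R (N + sumn Ns)).-integrable
    [set: (N + sumn Ns).-tuple (measurableTypeR R)] (EFin \o H) /\
  (\int[lebesgue_tuple R (N + sumn Ns)]_t (H t)%:E = 0)%E.
Proof.
move=> g1 gK H; have [dg Dg] := g1; have cg := Ck_continuous _ _ g1.
pose h j (x : V) : R := sg_X G k x 0 j * 'D_(delta_mx 0 j) g x.
have ch j : continuous (h j).
  apply: (CkM 0%N); last exact: Dg.
  exact: (Ck_continuous 1%N _ (sg_X_C1 G k j)).
have hK j x : h j x != 0 -> `|x| <= K.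
  by rewrite mulf_eq0 negb_or => /andP[_]; exact: derive_supp.
have HE t : (H t)%:E = (\sum_j (h j (rV_of_tuple t))%:E)%E.
  by rewrite /H derive_sum_coord// sumEFin.
have ih j : (lebesgue_tuple R (N + sumn Ns)).-integrable
    [set: (N + sumn Ns).-tuple (measurableTypeR R)]
    (fun t => (h j (rV_of_tuple t))%:E).
  have [K' bK'] := continuous_box_supported _ (h j) K (ch j) (hK j).
  exact: box_supported_integrable bK'.
have i0 j : (\int[lebesgue_tuple R (N + sumn Ns)]_t (h j (rV_of_tuple t))%:E = 0)%E.
  have [K' bK'] := continuous_box_supported _ (h j) K (ch j) (hK j).
  apply: (integral_slice0 _ j K' _ bK') => t.
  set y := rV_of_tuple (set_tnth _ t j 0).
  under eq_integral do rewrite rV_set_tnth -/y /h sg_X_coord_indep.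
  apply: (@integral_derivative0 _
    (fun s => sg_X G k y 0 j * g (y + s *: delta_mx 0 j)) _ (K + `|y|)).
  - move=> s; apply: is_deriveZ; exact: is_derive_line.
  - move=> s; apply: cvgM; first exact: cvg_cst.
    apply: (@continuous_comp _ _ _ (fun s : R => y + s *: delta_mx 0 j)
      (fun x => 'D_(delta_mx 0 j) g x)).
      by apply: cvgD; [exact: cvg_cst|exact: scalel_continuous].
    exact: Dg.
  - move=> s; rewrite mulf_eq0 negb_or => /andP[_ /gK h1].
    have := rV_coord_le _ (y + s *: delta_mx 0 j) j.
    rewrite /y !mxE tnth_mktuple !eqxx/= mulr1 add0r => h2.
    by apply: (le_trans h2); apply: (le_trans h1); rewrite lerDl.
split.
  rewrite (_ : EFin \o H = fun t => (\sum_j (h j (rV_of_tuple t))%:E)%E).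
    by apply: integrable_sum => // j _; exact: ih.
  by apply/funext => t; exact: HE.
under eq_integral do rewrite HE.
by rewrite integral_sum// big1.
Qed.

End Divergence.

(** * Regularity of powers *)

Section PowerCalculus.
Context {R : realType} {V : normedModType R}.
Implicit Types f h q : V -> R.

Lemma differentiable_flat h x : h x = 0 ->
  (forall e, 0 < e -> \forall y \near x, `|h y| <= e * `|y - x|) ->
  differentiable h x /\ forall w, 'D_w h x = 0.
Proof.
move=> hx0 hle.
have ho : h \o shift x = cst (h x) + (0 : V -> R) +o_ (0 : V) id.
  apply/eqaddoP => e e0; have := hle e e0; rewrite (near_shift 0 x) => H.
  near=> y; rewrite /= !fctE /= hx0 addr0 subr0.
  have : (fun y => `|h y| <= e * `|y - x|) (y + x) .
    by near: y; move: H; apply: filterS => z /=; rewrite subr0.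
  by rewrite addrK.
have d0 : 'd h x = 0 :> (V -> R).
  apply: diff_unique ho; exact: (dcst (W := R) (0 : R) x).1.
have dh : differentiable h x.
  apply/diff_locallyP; rewrite d0; split => //.
  exact: (dcst (W := R) (0 : R) x).1.
by split=> // w; rewrite deriveE// d0.
Unshelve. all: by end_near. Qed.

Lemma differentiable_lipschitz f x : differentiable f x ->
  exists2 C, 0 < C & \forall y \near x, `|f y - f x| <= C * `|y - x|.
Proof.
move=> df; have /diff_locallyP[cd /eqaddoP ho] := df.
have [k k0 kd] := linear_lipschitz cd.
exists (k + 1); first by rewrite addr_gt0.
have := ho 1 ltr01; rewrite [X in _ -> X](near_shift 0 x); apply: filterS => y /=.
rewrite subr0 addrK mul1r !fctE/= opprD addrA => H.
rewrite mulrDl mul1r -(subrK ('d f x y) (f (y + x) - f x)).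
apply: (le_trans (ler_normD _ _)); rewrite addrC; exact: lerD.
Qed.

Lemma cvg_powR0 (T : Type) (F : set_system T) {FF : Filter F} (Q : T -> R) s :
  0 < s -> (forall y, 0 <= Q y) -> Q @ F --> 0 -> Q y `^ s @[y --> F] --> 0.
Proof.
move=> s0 Q0 cQ; apply/cvgrPdist_le => e e0; near=> y.
rewrite sub0r normrN ger0_norm ?powR_ge0//.
have e1 : e = (e `^ s^-1) `^ s by rewrite -powRrM mulVf ?gt_eqF// powRr1// ltW.
rewrite e1; apply: ge0_ler_powR; rewrite ?nnegrE ?powR_ge0//; first exact: ltW.
near: y; have es0 : 0 < e `^ s^-1 by rewrite powR_gt0.
have /cvgrPdist_lt/(_ _ es0) := cQ; apply: filterS => y.
by rewrite sub0r normrN ger0_norm// => /ltW.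
Unshelve. all: by end_near. Qed.

Lemma continuous_powR_gt0 s (r : R) : 0 < r -> {for r, continuous (fun t : R => t `^ s)}.
Proof.
move=> r0; apply/differentiable_continuous/derivable1_diffP.
by apply: ex_derive; exact: is_derive1_powR.
Qed.

(** The derivative of a q^s is a' q^s + (s a q') q^(s-1), two terms of the same form:
    the induction on the order runs over all exponents at once. Where q is not
    positive, a vanishes nearby and the product is locally 0. *)
Lemma Ck_cutoff_powR k (a q : V -> R) s : Ck k a -> Ck k q ->
  (forall x, q x <= 0 -> \forall y \near x, a y = 0) ->
  Ck k (fun x => a x * q x `^ s).
Proof.
elim: k a q s => [|k IHk] a q s.
  move=> ca cq a0 x; have [qx|/a0 ax] := ltP 0 (q x).
    apply: cvgM; first exact: ca.
    apply: (@continuous_comp _ _ _ q (fun t => t `^ s)); first exact: cq.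
    exact: continuous_powR_gt0.
  have ax0 := nbhs_singleton ax.
  rewrite /continuous_at ax0 mul0r; apply: cvg_near_cst.
  by move: ax; apply: filterS => y ->; rewrite mul0r.
move=> ha hq a0; have [da Da] := ha; have [dq Dq] := hq.
have a0' v x : q x <= 0 -> \forall y \near x, 'D_v a y = 0.
  move=> /a0 /near_join; apply: filterS => y.
  exact: derive_near0.
have E x v : differentiable (fun x => a x * q x `^ s) x /\
   'D_v (fun x => a x * q x `^ s) x =
   'D_v a x * q x `^ s + (s *: (a x * 'D_v q x)) * q x `^ (s - 1).
  have [qx|qx] := ltP 0 (q x).
    have [dp Dp] := derive_comp1 _ q (fun t => t `^ s) x v _ (dq x) (is_derive1_powR s qx).
    split; first exact: (differentiableM (f := a) (g := (fun t => t `^ s) \o q)).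
    rewrite [LHS](deriveM (f := a) (g := (fun t => t `^ s) \o q)); try exact: diff_derivable.
    by rewrite Dp /GRing.scale/=; ring.
  have ax := a0 _ qx; have ax0 := nbhs_singleton ax.
  have n0 : \forall y \near x, a y * q y `^ s = 0.
    by move: ax; apply: filterS => y ->; rewrite mul0r.
  rewrite (derive_near0 _ _ _ v n0) (derive_near0 _ _ _ v ax) ax0.
  split; last by rewrite !mul0r scaler0 mul0r addr0.
  apply: (differentiable_flat _ x _ _).1; first by rewrite ax0 mul0r.
  move=> e e0; move: n0; apply: filterS => y ->.
  by rewrite normr0 mulr_ge0// ltW.
split=> [x|v]; first by have [] := E x 0.
apply: Ck_ext (CkD k _ _ (IHk _ _ s (Da v) (CkS _ _ hq) (a0' v))
  (IHk (fun x => s *: (a x * 'D_v q x)) q (s - 1) _ (CkS _ _ hq) _)).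
- by move=> x; have [_ ->] := E x v.
- by apply: (CkM k (fun=> s)); [exact: Ck_cst|apply: CkM; [exact: CkS|exact: Dq]].
- by move=> x /a0; apply: filterS => y ->; rewrite mul0r scaler0.
Qed.

End PowerCalculus.

Section ModulusPower.
Context {R : realType} {V : normedModType R}.
Variables (p : R) (u v : V -> R).
Hypotheses (p1 : 1 < p) (u1 : Ck 1 u) (v1 : Ck 1 v).

Let Q (x : V) : R := u x ^+ 2 + v x ^+ 2.

Let Q_ge0 x : 0 <= Q x. Proof. by rewrite addr_ge0// sqr_ge0. Qed.

Let Q_C1 : Ck 1 Q.
Proof. by apply: (CkD 1%N); apply: (CkM 1%N). Qed.

Let sqrtQ_le x : Num.sqrt (Q x) <= `|u x| + `|v x|.
Proof.
rewrite -[leRHS]ger0_norm ?addr_ge0// -sqrtr_sqr ler_sqrt ?sqr_ge0//.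
rewrite /Q -[u x ^+ 2]real_normK ?num_real// -[v x ^+ 2]real_normK ?num_real//.
rewrite sqrrD -subr_ge0; set a := `|u x|; set b := `|v x|.
rewrite (_ : _ - _ = a * b *+ 2); last by ring.
by rewrite mulrn_wge0// mulr_ge0// normr_ge0.
Qed.

Let derive_Q w x : 'D_w Q x = 2 * (u x * 'D_w u x + v x * 'D_w v x).
Proof.
have [du _] := u1; have [dv _] := v1.
have D2 (f : V -> R) : differentiable f x ->
    is_derive x w (fun y => f y ^+ 2) (2 * (f x * 'D_w f x)).
  move=> df; have D : is_derive x w f ('D_w f x) by apply/derivableP/diff_derivable.
  apply: is_derive_eq (is_deriveM D D) _.
  by rewrite /GRing.scale/= -mulr2n mulr_natl.
rewrite mulrDr; have Du := D2 u (du x); have Dv := D2 v (dv x).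
exact: (@derive_val _ _ _ _ _ _ _ (is_deriveD Du Dv)).
Qed.

Let E w x := p * Q x `^ (p / 2 - 1) * (u x * 'D_w u x + v x * 'D_w v x).

Let p20 : 0 < p / 2. Proof. by rewrite divr_gt0// (lt_trans _ p1). Qed.
Let pm0 : 0 < (p - 1) / 2. Proof. by rewrite divr_gt0// subr_gt0. Qed.

(** At a common zero of u and v, |(u, v)|^p is the product of |(u, v)|, which is
    O(|y - x|), and of |(u, v)|^(p - 1), which tends to 0. *)
Let derive_Qp x : differentiable (fun x => Q x `^ (p / 2)) x /\
  forall w, 'D_w (fun x => Q x `^ (p / 2)) x = E w x.
Proof.
have [dQ DQ] := Q_C1.
have [Qx|Qx] := ltP 0 (Q x).
  have D w := derive_comp1 _ Q (fun t => t `^ (p / 2)) x w _ (dQ x) (is_derive1_powR (p / 2) Qx).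
  split; first by have [] := D 0.
  move=> w; have [_ ->] := D w; rewrite derive_Q /E.
  by field.
have Qx0 : Q x = 0 by apply/eqP; rewrite eq_le Qx Q_ge0.
have /andP[/eqP ux /eqP vx] : (u x == 0) && (v x == 0).
  by move/eqP: Qx0; rewrite /Q paddr_eq0 ?sqr_ge0// !sqrf_eq0.
have [|e e0|dh Dh] := differentiable_flat (fun x => Q x `^ (p / 2)) x.
- by rewrite Qx0 powR0// gt_eqF.
- have [du _] := u1; have [dv _] := v1.
  have [C C0 uC] := differentiable_lipschitz u x (du x).
  have [C' C'0 vC] := differentiable_lipschitz v x (dv x).
  have CC0 : 0 < C + C' by rewrite addr_gt0.
  have eC : 0 < e / (C + C') by rewrite divr_gt0.
  have cQ : Q y `^ ((p - 1) / 2) @[y --> x] --> 0.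
    by apply: cvg_powR0 => //; have := Ck_continuous _ _ Q_C1 x; rewrite /continuous_at Qx0.
  have /cvgrPdist_le/(_ _ eC) hQ := cQ.
  near=> y.
  rewrite ger0_norm ?powR_ge0//.
  have pE : 2^-1 + (p - 1) / 2 = p / 2 by field.
  rewrite -pE powRD; last by rewrite pE gt_eqF.
  rewrite powR12_sqrt//.
  have h1 : Num.sqrt (Q y) <= (C + C') * `|y - x|.
    apply: (le_trans (sqrtQ_le y)); rewrite mulrDl lerD//.
      by near: y; move: uC; apply: filterS => y; rewrite ux subr0.
    by near: y; move: vC; apply: filterS => y; rewrite vx subr0.
  have h2 : Q y `^ ((p - 1) / 2) <= e / (C + C').
    near: y; move: hQ; apply: filterS => y.
    by rewrite sub0r normrN ger0_norm ?powR_ge0.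
  apply: (le_trans (ler_pM _ _ h1 h2)); rewrite ?sqrtr_ge0 ?powR_ge0//.
  by rewrite mulrAC mulrCA divff ?gt_eqF// mulr1.
split => // w; rewrite Dh /E ux vx !mul0r addr0 mulr0//.
Unshelve. all: by end_near. Qed.

Let E_bound w x : `|E w x| <= p * Q x `^ ((p - 1) / 2) * (`|'D_w u x| + `|'D_w v x|).
Proof.
rewrite /E !normrM ger0_norm ?(ltW (lt_trans ltr01 p1))// -!mulrA.
rewrite ler_pM2l ?(lt_trans ltr01 p1)// ger0_norm ?powR_ge0//.
have hu : `|u x| <= Num.sqrt (Q x).
  by rewrite -sqrtr_sqr ler_sqrt// lerDl sqr_ge0.
have hv : `|v x| <= Num.sqrt (Q x).
  by rewrite -sqrtr_sqr ler_sqrt// lerDr sqr_ge0.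
have [Qx0|Qn] := eqVneq (Q x) 0.
  rewrite Qx0 sqrtr0 in hu hv.
  have -> : u x = 0 by apply/eqP; rewrite -normr_le0.
  have -> : v x = 0 by apply/eqP; rewrite -normr_le0.
  by rewrite !mul0r addr0 normr0 mulr0 mulr_ge0 ?powR_ge0 ?addr_ge0.
have -> : (p - 1) / 2 = p / 2 - 1 + 2^-1 by field.
rewrite (@powRD _ (Q x) (p / 2 - 1) 2^-1); last by rewrite Qn implybT.
rewrite powR12_sqrt// -mulrA ler_wpM2l ?powR_ge0//.
apply: (le_trans (ler_normD _ _)); rewrite !normrM mulrDr.
by rewrite lerD// ler_wpM2r.
Qed.

(** For p < 2 the function t^(p/2) is singular at 0; continuity of the derivative at
    the zeros of (u, v) comes from its bound p |(u, v)|^(p-1) (|Du| + |Dv|). *)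
Lemma modulus_powR_C1 : Ck 1 (fun x => Q x `^ (p / 2)).
Proof.
split=> [x|w x]; first by have [] := derive_Qp x.
have [_ Du] := u1; have [_ Dv] := v1.
have cu := Ck_continuous _ _ u1; have cv := Ck_continuous _ _ v1.
have cQ := Ck_continuous _ _ Q_C1.
have -> : (fun x => 'D_w (fun x => Q x `^ (p / 2)) x) = E w.
  by apply/funext => y; have [_ ->] := derive_Qp y.
have [Qx|Qx] := ltP 0 (Q x).
  apply: cvgM.
    apply: cvgM; first exact: cvg_cst.
    apply: (@continuous_comp _ _ _ Q (fun t => t `^ (p / 2 - 1))); first exact: cQ.
    exact: continuous_powR_gt0.
  by apply: cvgD; apply: cvgM; [exact: cu|exact: Du|exact: cv|exact: Dv].
have Qx0 : Q x = 0 by apply/eqP; rewrite eq_le Qx Q_ge0.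
have Ex : E w x = 0.
  apply/eqP; rewrite -normr_le0; apply: (le_trans (E_bound w x)).
  by rewrite Qx0 powR0 ?gt_eqF// mulr0 mul0r.
rewrite /continuous_at Ex; apply/norm_cvg0P.
pose B y := p * Q y `^ ((p - 1) / 2) * (`|'D_w u y| + `|'D_w v y|).
apply: (@squeeze_cvgr _ _ _ _ (fun=> 0) B).
- by near=> y; rewrite normr_ge0/= E_bound.
- exact: cvg_cst.
- rewrite -(mul0r (`|'D_w u x| + `|'D_w v x|)) -(mulr0 p).
  apply: cvgM.
    apply: cvgM; first exact: cvg_cst.
    by apply: cvg_powR0 => //; have := cQ x; rewrite /continuous_at Qx0.
  by apply: cvgD; apply: cvg_norm; [exact: Du|exact: Dv].
Unshelve. all: by end_near. Qed.

Lemma derive_modulus_powR w x : 'D_w (fun x => (u x ^+ 2 + v x ^+ 2) `^ (p / 2)) x =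
  p * (u x ^+ 2 + v x ^+ 2) `^ (p / 2 - 1) * (u x * 'D_w u x + v x * 'D_w v x).
Proof. by have [_ ->] := derive_Qp x. Qed.

End ModulusPower.

(** * The Hardy inequality *)

Section Inequalities.
Context {R : realType}.

(** Expand the nonnegative sum of the (x_i S - y_i X)^2, with S the sum of the
    x_i y_i and X that of the x_i^2. *)
Lemma cauchy_schwarz_sum (I : finType) (x y : I -> R) :
  `|\sum_i x i * y i| <= Num.sqrt (\sum_i x i ^+ 2) * Num.sqrt (\sum_i y i ^+ 2).
Proof.
set X := \sum_i x i ^+ 2; set Y := \sum_i y i ^+ 2; set S := \sum_i _.
have X0 : 0 <= X by apply: sumr_ge0 => i _; exact: sqr_ge0.
have Y0 : 0 <= Y by apply: sumr_ge0 => i _; exact: sqr_ge0.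
rewrite -sqrtrM// -sqrtr_sqr ler_sqrt ?mulr_ge0//.
have [X00|Xn0] := eqVneq X 0.
  have x0 i : x i = 0.
    apply/eqP; rewrite -sqrf_eq0; apply/eqP.
    by apply: (psumr_eq0P (P := xpredT) (F := fun i => x i ^+ 2)) => // j _; exact: sqr_ge0.
  by rewrite /S big1 ?expr0n ?mulr_ge0// => i _; rewrite x0 mul0r.
have Xp : 0 < X by rewrite lt_def Xn0.
have h : 0 <= \sum_i (x i * S - y i * X) ^+ 2 by apply: sumr_ge0 => i _; exact: sqr_ge0.
have e : \sum_i (x i * S - y i * X) ^+ 2 = X * (X * Y - S ^+ 2).
  transitivity (\sum_i (x i ^+ 2 * S ^+ 2 - x i * y i * (2 * S * X) + y i ^+ 2 * X ^+ 2)).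
    by apply: eq_bigr => i _; ring.
  by rewrite big_split sumrB -!mulr_suml -/X -/Y -/S /=; ring.
by rewrite e pmulr_rge0// subr_ge0 in h.
Qed.

(** Here m is |F|, B the length of the horizontal gradient and D the horizontal
    divergence of x' |F|^p, which integrates to 0. With c = |n - p| / p, Young's
    inequality for B (c m)^(p-1) bounds B^p from below by
    p B (c m)^(p-1) - (p-1) (c m)^p, and the hypothesis bounds B m^(p-1) from below by
    c m^p up to a multiple of D. *)
Lemma hardy_pointwise (p n m B D : R) : 1 < p -> 0 <= m -> 0 <= B ->
  `|D - (n - p) * m `^ p| <= p * (m `^ (p - 1) * B) ->
  (`|n - p| / p) `^ p * m `^ p - Num.sg (n - p) * (`|n - p| / p) `^ (p - 1) * D
    <= B `^ p.
Proof.
move=> p1 m0 B0 hD; have p0 : 0 < p by rewrite (lt_trans _ p1).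
set c := `|n - p| / p; set s := Num.sg (n - p).
have c0 : 0 <= c by rewrite divr_ge0// ltW.
have pc : p * c = `|n - p| by rewrite /c mulrC divfK// gt_eqF.
have sn : s * (n - p) = `|n - p| by rewrite normrEsg.
pose q := p / (p - 1).
have pm : 0 < p - 1 by rewrite subr_gt0.
have q0 : 0 < q by rewrite divr_gt0.
have pq : p^-1 + q^-1 = 1 by rewrite /q invf_div; field; rewrite !gt_eqF.
have cm0 : 0 <= (c * m) `^ (p - 1) by exact: powR_ge0.
have Y : B * (c * m) `^ (p - 1) <= B `^ p / p + ((c * m) `^ (p - 1)) `^ q / q.
  exact: conjugate_powR.
rewrite -powRrM (_ : (p - 1) * q = p) in Y; last by rewrite /q; field; rewrite gt_eqF.
rewrite !(powRM _ c0 m0) in Y.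
set mp := m `^ p in hD Y *; set M := m `^ (p - 1) in hD Y cm0.
set cp := c `^ p in Y *; set C := c `^ (p - 1) in Y *.
have C0 : 0 <= C by exact: powR_ge0.
have cC : c * C = cp by rewrite mulr_powRB1.
have h1 : `|n - p| * mp - s * D <= p * (M * B).
  apply: le_trans hD; rewrite -sn -mulrA -mulrBr; apply: (le_trans (ler_norm _)).
  by rewrite normrM [X in _ <= X]distrC ler_piMl// /s normr_sg lern1 leq_b1.
have h2 := ler_wpM2l C0 h1.
have pY := ler_wpM2l (ltW p0) Y.
have e1 : p * (B `^ p / p + cp * mp / q) = B `^ p + (p - 1) * (cp * mp).
  by rewrite /q; field; rewrite !gt_eqF.
have e2 : C * (`|n - p| * mp - s * D) = p * (cp * mp) - s * C * D.
  by rewrite -pc -cC; ring.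
have e3 : p * (B * (C * M)) = C * (p * (M * B)) by ring.
rewrite e1 in pY; rewrite e2 -e3 in h2.
have h3 := le_trans h2 pY.
have e4 : p * (cp * mp) = cp * mp + (p - 1) * (cp * mp) by ring.
by move: h3; rewrite e4; lra.
Qed.

End Inequalities.

Section HardyReal.
Context {R : realType} {N : nat} {Ns : seq nat} (G : stratifiedGroup R N Ns).
Notation V := 'rV[R]_(N + sumn Ns).

(** The square of |x'|: unlike |x'| itself it is smooth where x' = 0. *)
Definition hsq (x : V) : R := \sum_(k < N) x 0 (lshift (sumn Ns) k) ^+ 2.

Lemma hsq_ge0 x : 0 <= hsq x.
Proof. by apply: sumr_ge0 => k _; exact: sqr_ge0. Qed.

Lemma Ck_hsq k : Ck k hsq.
Proof. by apply: Ck_sum => i; apply: (CkM k); exact: Ck_coord. Qed.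

Lemma derive_hsq k x : 'D_(sg_X G k x) hsq x = 2 * x 0 (lshift (sumn Ns) k).
Proof.
pose c i (y : V) : R := y 0 (lshift (sumn Ns) i).
have dc i y w : derivable (c i) y w by apply: diff_derivable; exact: differentiable_rV_coord.
rewrite (_ : hsq = \sum_(i < N) (c i * c i)); last first.
  by apply/funext => y; rewrite fct_sumE; apply: eq_bigr => i _; rewrite expr2.
rewrite derive_sum => [|i]; last exact: derivableM.
rewrite (bigD1 k)//= big1 => [|i ik].
  by rewrite deriveM// derive_rV_coord sg_X_first_stratum eqxx /GRing.scale/= /c; ring.
by rewrite deriveM// derive_rV_coord sg_X_first_stratum (negbTE ik) !scaler0 addr0.
Qed.

Variables (p : R) (a b : V -> R) (K : R).
Hypotheses (p1 : 1 < p) (a1 : Ck 1 a) (b1 : Ck 1 b).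
Hypotheses (aK : forall x, a x != 0 -> `|x| <= K) (bK : forall x, b x != 0 -> `|x| <= K).
Hypothesis a0 : forall x, hsq x <= 0 -> \forall y \near x, a y = 0.
Hypothesis b0 : forall x, hsq x <= 0 -> \forall y \near x, b y = 0.

Let u x := a x * hsq x `^ (- 2^-1).
Let v x := b x * hsq x `^ (- 2^-1).
Let h x := (u x ^+ 2 + v x ^+ 2) `^ (p / 2).
Let m x := Num.sqrt (a x ^+ 2 + b x ^+ 2) / Num.sqrt (hsq x).
Let B x := Num.sqrt (\sum_k ('D_(sg_X G k x) a x ^+ 2 + 'D_(sg_X G k x) b x ^+ 2)).

Let u1 : Ck 1 u. Proof. exact: (Ck_cutoff_powR 1%N _ _ _ a1 (Ck_hsq 1%N) a0). Qed.
Let v1 : Ck 1 v. Proof. exact: (Ck_cutoff_powR 1%N _ _ _ b1 (Ck_hsq 1%N) b0). Qed.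
Let h1 : Ck 1 h. Proof. exact: modulus_powR_C1. Qed.

Let p0 : 0 < p. Proof. exact: lt_trans p1. Qed.

Let hpow x : hsq x `^ (- 2^-1) = (Num.sqrt (hsq x))^-1.
Proof. by rewrite powRN powR12_sqrt// hsq_ge0. Qed.

Let mE x : m x = Num.sqrt (u x ^+ 2 + v x ^+ 2).
Proof.
rewrite /u /v hpow !exprMn -mulrDl sqrtrM ?addr_ge0 ?sqr_ge0//.
by rewrite sqrtr_sqr ger0_norm ?invr_ge0 ?sqrtr_ge0.
Qed.

Let hE x : h x = m x `^ p.
Proof.
rewrite mE -powR12_sqrt ?addr_ge0 ?sqr_ge0//.
by rewrite -powRrM mulrC.
Qed.

Let hK x : h x != 0 -> `|x| <= K.
Proof.
have [ax|ax _] := eqVneq (a x) 0; last exact: aK.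
have [bx|bx _] := eqVneq (b x) 0; last exact: bK.
rewrite /h /u /v ax bx !mul0r expr0n addr0 powR0 ?eqxx//.
by rewrite gt_eqF// divr_gt0.
Qed.

Let g (k : 'I_N) (x : V) : R := x 0 (lshift (sumn Ns) k) * h x.

Let g1 k : Ck 1 (g k).
Proof. by apply: (CkM 1%N); [exact: Ck_coord|exact: h1]. Qed.

Let gK k x : g k x != 0 -> `|x| <= K.
Proof. by rewrite mulf_eq0 negb_or => /andP[_]; exact: hK. Qed.

Let div x : R := \sum_k 'D_(sg_X G k x) (g k) x.

(** Euler's relation: differentiating F = f / |x'| radially in x' gives back -F, which
    turns the factor N, the divergence of x', into N - p. The remaining term is
    controlled by the Cauchy-Schwarz inequality. *)
Let div_bound x : `|div x - (N%:R - p) * m x `^ p| <= p * (m x `^ (p - 1) * B x).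
Proof.
have [dh _] := h1.
have divE : div x = N%:R * h x + \sum_k x 0 (lshift (sumn Ns) k) * 'D_(sg_X G k x) h x.
  rewrite /div -[N in N%:R]card_ord -sum1_card natr_sum mulr_suml -big_split/=.
  apply: eq_bigr => k _.
  rewrite [LHS](deriveM (f := fun x : V => x 0 (lshift (sumn Ns) k) : R) (g := h)).
  - by rewrite derive_rV_coord sg_X_first_stratum eqxx /GRing.scale/= mulr1 mul1r addrC.
  - by apply: diff_derivable; exact: differentiable_rV_coord.
  - exact: diff_derivable.
have [qx|qx] := ltP 0 (hsq x); last first.
  have h0 : \forall y \near x, h y = 0.
    have := a0 _ qx; have := b0 _ qx; apply: filterS2 => y by0 ay0.
    by rewrite /h /u /v ay0 by0 !mul0r expr0n addr0 powR0// gt_eqF// divr_gt0.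
  rewrite divE (nbhs_singleton h0) big1 => [|k _]; last by rewrite derive_near0// mulr0.
  rewrite -hE (nbhs_singleton h0) !mulr0 addr0 subr0 normr0.
  by rewrite mulr_ge0 ?(ltW p0)// mulr_ge0 ?powR_ge0 ?sqrtr_ge0.
pose y (k : 'I_N) : R := x 0 (lshift (sumn Ns) k).
pose i := hsq x `^ (- 2^-1).
have i0 : 0 <= i by exact: powR_ge0.
have iE : i = (Num.sqrt (hsq x))^-1 by exact: hpow.
have ri : Num.sqrt (hsq x) * i = 1.
  by rewrite iE mulfV// gt_eqF// sqrtr_gt0.
have i3 : hsq x `^ (- 2^-1 - 1) = i * (hsq x)^-1.
  rewrite (@powRD _ (hsq x) (- 2^-1) (- 1)) ?(gt_eqF qx) ?implybT//.
  by rewrite -/i [X in _ * X]powRN powRr1// hsq_ge0.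
have Dcut (f : V -> R) k : differentiable f x ->
    'D_(sg_X G k x) (fun x => f x * hsq x `^ (- 2^-1)) x =
    'D_(sg_X G k x) f x * i - f x * y k * (i * (hsq x)^-1).
  move=> df; have [dq _] := Ck_hsq 1%N.
  have [dp Dp] := derive_comp1 _ hsq (fun t => t `^ (- 2^-1)) x (sg_X G k x) _
    (dq x) (is_derive1_powR (- 2^-1) qx).
  rewrite [LHS](deriveM (f := f) (g := (fun t => t `^ (- 2^-1)) \o hsq)); try exact: diff_derivable.
  by rewrite Dp derive_hsq i3 /GRing.scale/= -/i -/(y k); field; rewrite gt_eqF.
have [da _] := a1; have [db _] := b1.
pose Q := u x ^+ 2 + v x ^+ 2.
have Q0 : 0 <= Q by rewrite addr_ge0 ?sqr_ge0.
pose alp k := 'D_(sg_X G k x) a x; pose bet k := 'D_(sg_X G k x) b x.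
pose T := \sum_k y k * (u x * alp k + v x * bet k).
have DT : \sum_k y k * 'D_(sg_X G k x) h x = p * Q `^ (p / 2 - 1) * i * T - p * h x.
  rewrite {2}/h -/Q -(@mulr_powRB1 _ Q (p / 2))// ?divr_gt0//.
  set P := Q `^ _.
  transitivity (p * P * i * T -
      p * P * (i * (u x * a x + v x * b x) * ((hsq x)^-1 * \sum_k y k ^+ 2))).
    rewrite /T !mulr_sumr -sumrB; apply: eq_bigr => k _.
    rewrite /h derive_modulus_powR// -/Q -/P.
    rewrite (Dcut a k (da x)) (Dcut b k (db x)) -/(alp k) -/(bet k).
    by ring.
  rewrite -/(hsq x) mulVf ?gt_eqF// /Q /u /v -/i; ring.
have B0 : 0 <= B x by exact: sqrtr_ge0.
have TB : `|T| <= Num.sqrt (hsq x) * (m x * B x).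
  apply: (le_trans (cauchy_schwarz_sum _ _ _)).
  rewrite -/(hsq x) ler_wpM2l ?sqrtr_ge0// mE -/Q -sqrtrM// ler_sqrt; last first.
    by rewrite mulr_ge0// sumr_ge0// => k _; rewrite addr_ge0 ?sqr_ge0.
  rewrite mulr_sumr; apply: ler_sum => k _; rewrite -/(alp k) -/(bet k) -subr_ge0.
  rewrite (_ : _ - _ = (u x * bet k - v x * alp k) ^+ 2) ?sqr_ge0//.
  by rewrite /Q; ring.
rewrite divE DT -hE (_ : _ - _ = p * (Q `^ (p / 2 - 1) * i * T)); last by ring.
rewrite normrM (gtr0_norm p0) ler_pM2l// !normrM (ger0_norm i0) (ger0_norm (powR_ge0 _ _)).
have h2 : i * `|T| <= m x * B x.
  by have := ler_wpM2l i0 TB; rewrite (mulrA i) (mulrC i (Num.sqrt _)) ri mul1r.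
rewrite -mulrA; apply: (le_trans (ler_wpM2l (powR_ge0 _ _) h2)).
rewrite mulrA ler_wpM2r// mE -/Q.
have [Qz|Qn] := eqVneq Q 0; first by rewrite Qz sqrtr0 mulr0 powR_ge0.
rewrite -powR12_sqrt// -powRrM -powRD ?Qn ?implybT//.
by rewrite (_ : p / 2 - 1 + 2^-1 = 2^-1 * (p - 1))//; field.
Qed.

Let continuous_B : continuous B.
Proof.
move=> x.
apply: (@continuous_comp _ _ _
  (fun x => \sum_k ('D_(sg_X G k x) a x ^+ 2 + 'D_(sg_X G k x) b x ^+ 2)) Num.sqrt);
  last exact: sqrt_continuous.
have cS : Ck 0 (fun x => \sum_k ('D_(sg_X G k x) a x ^+ 2 + 'D_(sg_X G k x) b x ^+ 2)).
  by apply: Ck_sum => k; apply: (CkD 0%N); apply: (CkM 0%N); exact: continuous_sg_X_derive.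
exact: cS.
Qed.

Notation mu := (lebesgue_tuple R (N + sumn Ns)).
Notation rv := (@rV_of_tuple R (N + sumn Ns)).

(** The vector field x' |F|^p is C^1 with compact support, so its divergence drops out
    when the pointwise inequality is integrated. *)
Lemma hardy_integral :
  [/\ (((`|N%:R - p| / p) `^ p)%:E * \int[mu]_t (m (rv t) `^ p)%:E
        <= \int[mu]_t (B (rv t) `^ p)%:E)%E,
      measurable_fun [set: (N + sumn Ns).-tuple (measurableTypeR R)] (fun t => m (rv t)),
      measurable_fun [set: (N + sumn Ns).-tuple (measurableTypeR R)] (fun t => B (rv t)),
      continuous (fun x => m x `^ p) &
      (\int[mu]_t (m (rv t) `^ p)%:E < +oo)%E].
Proof.
have [K' bh] := continuous_box_supported _ h K (Ck_continuous _ _ h1) hK.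
have ih := box_supported_integrable _ _ _ bh.
have gI k := integral_sg_X_derive0 G k (g k) K (g1 k) (gK k).
have dE t : (div (rv t))%:E = (\sum_k ('D_(sg_X G k (rv t)) (g k) (rv t))%:E)%E.
  by rewrite /div sumEFin.
have id : mu.-integrable [set: (N + sumn Ns).-tuple (measurableTypeR R)]
    (fun t => (div (rv t))%:E).
  under eq_fun do rewrite dE.
  by apply: integrable_sum => // k _; exact: (gI k).1.
have d0 : (\int[mu]_t (div (rv t))%:E = 0)%E.
  under eq_integral do rewrite dE.
  rewrite integral_sum => [|//|k]; last exact: (gI k).1.
  by rewrite big1 => // k _; exact: (gI k).2.
have mm : measurable_fun [set: (N + sumn Ns).-tuple (measurableTypeR R)] (fun t => m (rv t)).
  under eq_fun do rewrite mE.
  apply: (continuous_measurable_tuple _ (fun x => Num.sqrt (u x ^+ 2 + v x ^+ 2))).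
  move=> x; apply: (@continuous_comp _ _ _ (fun x => u x ^+ 2 + v x ^+ 2) Num.sqrt);
    last exact: sqrt_continuous.
  have cu := Ck_continuous 1%N _ u1; have cv := Ck_continuous 1%N _ v1.
  have cS : Ck 0 (fun x => u x ^+ 2 + v x ^+ 2).
    by apply: (CkD 0%N); apply: (CkM 0%N).
  exact: cS.
have mB := continuous_measurable_tuple _ _ continuous_B.
have ihm : mu.-integrable [set: (N + sumn Ns).-tuple (measurableTypeR R)]
    (fun t => (m (rv t) `^ p)%:E).
  by under eq_fun do rewrite -hE; exact: ih.
have cm : continuous (fun x => m x `^ p).
  by rewrite (_ : (fun x => m x `^ p) = h);
    [exact: (Ck_continuous _ _ h1)|apply/funext => x; rewrite hE].
split => //; last first.
  move: (ihm) => /integrableP[_]; apply: le_lt_trans; apply: ge0_le_integral => //.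
  - by move=> t _; rewrite lee_fin powR_ge0.
  - exact: measurable_int ihm.
  - by apply: measurableT_comp => //; exact: measurable_int ihm.
  - by move=> t _; rewrite gee0_abs// lee_fin powR_ge0.
set c := `|_| / p; set s := Num.sg (N%:R - p).
have -> : ((c `^ p)%:E * \int[mu]_t (m (rv t) `^ p)%:E =
    \int[mu]_t ((c `^ p * m (rv t) `^ p)%:E - (s * c `^ (p - 1) * div (rv t))%:E))%E.
  rewrite integralB//; last 2 first.
  - by under eq_fun do rewrite EFinM; exact: integrableZl.
  - by under eq_fun do rewrite EFinM; exact: integrableZl.
  under eq_integral do rewrite EFinM.
  under [X in (_ = _ - X)%E]eq_integral do rewrite EFinM.
  by rewrite integralZl// integralZl// d0 mule0 sube0.
have [->|Boo] := eqVneq (\int[mu]_t (B (rv t) `^ p)%:E)%E +oo%E; first exact: leey.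
have mBp : measurable_fun [set: (N + sumn Ns).-tuple (measurableTypeR R)]
    (fun t => (B (rv t) `^ p)%:E).
  by apply/measurable_EFinP; exact: (measurableT_comp (measurable_powR p) mB).
apply: le_integral => //.
- by apply: integrableB => //; under eq_fun do rewrite EFinM; exact: integrableZl.
- apply/integrableP; split => //; rewrite lt_neqAle leey andbT.
  apply: contra_neq Boo => <-; apply: eq_integral => t _.
  by rewrite gee0_abs// lee_fin powR_ge0.
- move=> t _; rewrite -EFinB lee_fin.
  by apply: hardy_pointwise => //; rewrite ?sqrtr_ge0// /m divr_ge0 ?sqrtr_ge0.
Qed.

End HardyReal.

Section LpNorms.
Context {R : realType}.

Lemma LpnormE n (p : R) (g : 'rV[R]_n -> R) : 0 < p -> (forall x, 0 <= g x) ->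
  Lpnorm p g = ((\int[lebesgue_tuple R n]_t (g (rV_of_tuple t) `^ p)%:E) `^ p^-1)%E.
Proof.
move=> p0 g0; rewrite /Lpnorm unlock /= ; congr (_ `^ _)%E.
by apply: eq_integral => t _; rewrite ger0_norm.
Qed.

Lemma cmodE (z : R[i]) : cmod z = Num.sqrt (complex.Re z ^+ 2 + complex.Im z ^+ 2).
Proof. by case: z. Qed.

Lemma cmod_ge0 (z : R[i]) : 0 <= cmod z.
Proof. by rewrite cmodE sqrtr_ge0. Qed.

End LpNorms.

Section HardyComplex.
Context {R : realType} {N : nat} {Ns : seq nat} (G : stratifiedGroup R N Ns).
Notation V := 'rV[R]_(N + sumn Ns).

Lemma enorm_hsq (x : V) : enorm (lsubmx x) = Num.sqrt (hsq x).
Proof. by rewrite /enorm; congr Num.sqrt; apply: eq_bigr => i _; rewrite mxE. Qed.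

Lemma cmod_hardy_quotient (f : V -> R[i]) x :
  cmod (hardy_quotient f x) =
  Num.sqrt (complex.Re (f x) ^+ 2 + complex.Im (f x) ^+ 2) / Num.sqrt (hsq x).
Proof.
rewrite /hardy_quotient /cmod ComplexField.Normc.normcM ComplexField.Normc.normcV.
rewrite -!/(cmod _) !cmodE /= expr0n addr0 sqrtr_sqr enorm_hsq.
by rewrite ger0_norm ?sqrtr_ge0.
Qed.

Lemma cenorm_hgrad (f : V -> R[i]) x :
  cenorm (hgrad G f x) = Num.sqrt (\sum_k
    ('D_(sg_X G k x) (fun y => complex.Re (f y)) x ^+ 2 +
     'D_(sg_X G k x) (fun y => complex.Im (f y)) x ^+ 2)).
Proof.
rewrite /cenorm; congr Num.sqrt; apply: eq_bigr => k _.
by rewrite mxE cmodE sqr_sqrtr// addr_ge0 ?sqr_ge0.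
Qed.

Lemma hsq_le0 (x : V) : hsq x <= 0 -> lsubmx x = 0.
Proof.
move=> qx; have /eqP : hsq x = 0 by apply/eqP; rewrite eq_le qx hsq_ge0.
rewrite psumr_eq0 => [/allP h|k _]; last exact: sqr_ge0.
apply/rowP => k; rewrite !mxE; apply/eqP.
by have := h k (mem_index_enum _); rewrite sqrf_eq0.
Qed.

Lemma test_function_hardy_integral (p : R) (f : V -> R[i]) : 1 < p ->
  test_function (@first_stratum_neq0 R N Ns) f ->
  let mu := lebesgue_tuple R (N + sumn Ns) in
  [/\ (((`|N%:R - p| / p) `^ p)%:E *
        \int[mu]_t (cmod (hardy_quotient f (rV_of_tuple t)) `^ p)%:E
        <= \int[mu]_t (cenorm (hgrad G f (rV_of_tuple t)) `^ p)%:E)%E,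
      measurable_fun [set: (N + sumn Ns).-tuple (measurableTypeR R)]
        (fun t => cmod (hardy_quotient f (rV_of_tuple t))),
      measurable_fun [set: (N + sumn Ns).-tuple (measurableTypeR R)]
        (fun t => cenorm (hgrad G f (rV_of_tuple t))),
      continuous (fun x => cmod (hardy_quotient f x) `^ p) &
      (\int[mu]_t (cmod (hardy_quotient f (rV_of_tuple t)) `^ p)%:E < +oo)%E].
Proof.
move=> p1 [fa fb fc fs] mu.
have f0 x : csupport f x \/ f x = 0.
  have [->|fx] := eqVneq (f x) 0; [by right|left].
  exact: subset_closure.
have [K fK] : exists K, forall x, f x != 0 -> `|x| <= K.
  have [M [_ hM]] := compact_bounded fc.
  exists (`|M| + 1) => x fx; apply: hM; first by rewrite ltr_pwDr// ler_norm.
  by have [//|/eqP] := f0 x; rewrite (negbTE fx).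
have fz x : hsq x <= 0 -> \forall y \near x, f y = 0.
  move=> /hsq_le0 lx.
  have : nbhs x (~` csupport f).
    apply: open_nbhs_nbhs; split; first exact/closed_openC/closed_closure.
    by move=> /fs; rewrite /first_stratum_neq0/= lx eqxx.
  by apply: filterS => y ny; have [] := f0 y.
have H := hardy_integral G p (fun x => complex.Re (f x)) (fun x => complex.Im (f x)) K p1
  (fa 1%N) (fb 1%N).
have [] := H.
- by move=> x h; apply: fK; apply: contra_neq h => ->.
- by move=> x h; apply: fK; apply: contra_neq h => ->.
- by move=> x /fz; apply: filterS => y ->.
- by move=> x /fz; apply: filterS => y ->.
move=> h1 h2 h3 h4 h5; split.
- under eq_integral do rewrite cmod_hardy_quotient.
  by under [X in (_ <= X)%E]eq_integral do rewrite cenorm_hgrad.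
- by under eq_fun do rewrite cmod_hardy_quotient.
- by under eq_fun do rewrite cenorm_hgrad.
- rewrite (_ : (fun x => _ `^ p) = (fun x => (Num.sqrt (complex.Re (f x) ^+ 2 +
    complex.Im (f x) ^+ 2) / Num.sqrt (hsq x)) `^ p))//.
  by apply/funext => x; rewrite cmod_hardy_quotient.
- by under eq_integral do rewrite cmod_hardy_quotient.
Qed.

Lemma hardy_inequality (p : R) (f : V -> R[i]) : 1 < p ->
  test_function (@first_stratum_neq0 R N Ns) f ->
  ((`|N%:R - p| / p)%:E * Lpnorm p (fun x => cmod (hardy_quotient f x))
            <= Lpnorm p (fun x => cenorm (hgrad G f x)))%E.
Proof.
move=> p1 tf; have p0 : 0 < p by rewrite (lt_trans _ p1).
have [H _ _ _ _] := test_function_hardy_integral p f p1 tf.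
rewrite !LpnormE//; first last.
- by move=> x; exact: cmod_ge0.
- by move=> x; exact: sqrtr_ge0.
set c := `|_| / p in H *.
have c0 : 0 <= c by rewrite divr_ge0// ltW.
have -> : c%:E = ((c `^ p)%:E `^ p^-1)%E.
  by rewrite poweR_EFin -powRrM mulfV ?gt_eqF// powRr1.
rewrite -poweRM; first last.
- by apply: integral_ge0 => t _; rewrite lee_fin powR_ge0.
- by rewrite lee_fin powR_ge0.
apply: gt0_ler_poweR; rewrite ?in_itv/= ?leey ?andbT ?invr_ge0 ?(ltW p0)//.
- apply: mule_ge0; first by rewrite lee_fin powR_ge0.
  by apply: integral_ge0 => t _; rewrite lee_fin powR_ge0.
- by apply: integral_ge0 => t _; rewrite lee_fin powR_ge0.
Qed.

End HardyComplex.

(** * Smooth cutoffs *)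

Section Bump.
Context {R : realType}.

(** For n = 0 this is the classical flat function exp(-1/x). The whole family is
    considered because its span is closed under differentiation. *)
Definition flat_exp (n : nat) (x : R) : R :=
  if 0 < x then x^-1 ^+ n * expR (- x^-1) else 0.

(** Raise exp (y / n) >= y / n to the power n. *)
Lemma exprn_expRN_le (n : nat) (y : R) : 0 <= y -> y ^+ n * expR (- y) <= n%:R ^+ n.
Proof.
move=> y0; case: n => [|n]; first by rewrite !expr0 mul1r -expR0 ler_expR oppr_le0.
rewrite expRN ler_pdivrMr ?expR_gt0//.
have -> : expR y = expR (y / n.+1%:R) ^+ n.+1.
  by rewrite -expRM_natl mulrC divfK// pnatr_eq0.
rewrite -exprMn lerXn2r// ?nnegrE ?mulr_ge0 ?expR_ge0//.
rewrite -ler_pdivrMl ?ltr0n// mulrC.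
by apply: le_trans (expR_ge1Dx _); rewrite lerDr.
Qed.

Let flat_exp_le n (x : R) : `|flat_exp n x| <= n.+2%:R ^+ n.+2 * `|x| ^+ 2.
Proof.
rewrite /flat_exp; case: ifPn => [x0|_]; last by rewrite normr0 mulr_ge0// exprn_ge0.
rewrite ger0_norm ?mulr_ge0 ?expR_ge0 ?exprn_ge0 ?invr_ge0 ?(ltW x0)//.
rewrite (gtr0_norm x0) -ler_pdivrMr ?exprn_gt0//.
have := exprn_expRN_le n.+2 x^-1; rewrite invr_ge0 => /(_ (ltW x0)).
by apply: le_trans; rewrite -exprVn mulrAC -exprD addn2.
Qed.

Let is_derive_flat_exp n (x : R) :
  is_derive x (1 : R) (flat_exp n) (- n%:R * flat_exp n.+1 x + flat_exp n.+2 x).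
Proof.
have [x0|x0] := ltP 0 x.
  have xn0 : x != 0 by rewrite gt_eqF.
  have D : is_derive x (1 : R) ((fun y : R => y^-1 ^+ n * expR (- y^-1)))
      (- n%:R * flat_exp n.+1 x + flat_exp n.+2 x).
    have DV : is_derive x (1 : R) (fun y : R => y^-1) (- x ^- 2).
      apply: DeriveDef; first exact: (derivableV (f := id)).
      by rewrite (deriveV (f := id))// derive_id /GRing.scale/= mulr1.
    have D1 (z : R) : is_derive z (1 : R) (fun z : R => z ^+ n) (n%:R * z ^+ n.-1).
      apply: DeriveDef; first exact: exprn_derivable.
      by rewrite exp_derive /GRing.scale/= mulr1.
    have D2 (z : R) : is_derive z (1 : R) (fun z : R => expR (- z)) (- expR (- z)).
      have := is_derive1_comp (is_derive_expR (- z)) (is_deriveNid z 1).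
      by rewrite mulrN1.
    have D3 := is_derive1_comp (is_deriveM (D1 x^-1) (D2 x^-1)) DV.
    apply: is_derive_eq D3 _.
    rewrite /flat_exp x0 /GRing.scale/= -exprVn.
    set y := x^-1; set E := expR _.
    by case: {D1 D2} n => [|m]; rewrite /= !exprS; ring.
  apply: (near_eq_is_derive _ D); near=> y; rewrite /flat_exp ifT//.
  by near: y; exact: lt_nbhsr.
have -> : - n%:R * flat_exp n.+1 x + flat_exp n.+2 x = 0.
  by rewrite /flat_exp !ifF ?mulr0 ?addr0// ltNge x0.
have [dh Dh] : differentiable (flat_exp n) x /\ forall w, 'D_w (flat_exp n) x = 0.
  apply: differentiable_flat; first by rewrite /flat_exp ifF// ltNge x0.
  move=> e e0; have [xn|xp] := ltP x 0.
    near=> y; rewrite /flat_exp ifF ?normr0 ?mulr_ge0// ?(ltW e0)//.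
    by apply/negbTE; rewrite -leNgt ltW//; near: y; exact: lt_nbhsl.
  have -> : x = 0 by apply/eqP; rewrite eq_le x0 xp.
  near=> y; rewrite subr0; apply: (le_trans (flat_exp_le n y)).
  rewrite expr2 mulrA ler_wpM2r// -ler_pdivlMl ?exprn_gt0//.
  near: y; apply: (@nbhs0_le _ R); rewrite mulr_gt0// invr_gt0 exprn_gt0.
apply: DeriveDef; [exact/derivable1_diffP|exact: Dh].
Unshelve. all: by end_near. Qed.

Lemma Ck_flat_exp k n : Ck k (flat_exp n).
Proof.
elim: k n => [|k IHk] n.
  move=> x; apply/differentiable_continuous/derivable1_diffP.
  by apply: ex_derive; exact: is_derive_flat_exp.
apply: (Ck_derive1 _ k _ _ (is_derive_flat_exp n)).
apply: CkD => //; apply: (CkM k (fun=> _)) => //; exact: Ck_cst.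
Qed.

Definition bump (s : R) : R := flat_exp 0 (1 - s) * flat_exp 0 (1 + s).

Lemma Ck_affine k (a b : R) : Ck k (fun s : R => a + b * s).
Proof.
have Ci j : Ck j (id : R -> R).
  case: j => [|j]; first by move=> x; exact: cvg_id.
  apply: (Ck_derive1 _ j id (fun=> 1)); exact: Ck_cst.
apply: (CkD k (fun=> a) (fun s : R => b * s)); first exact: Ck_cst.
by apply: (CkM k (fun=> b) id); [exact: Ck_cst|exact: Ci].
Qed.

Lemma Ck_bump k : Ck k bump.
Proof.
apply: CkM.
  apply: Ck_ext (Ck_comp k (flat_exp 0) _ (Ck_flat_exp k 0) (Ck_affine k 1 (-1))) => s /=.
  by rewrite mulN1r.
apply: Ck_ext (Ck_comp k (flat_exp 0) _ (Ck_flat_exp k 0) (Ck_affine k 1 1)) => s /=.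
by rewrite mul1r.
Qed.

Let flat0_ge0 x : 0 <= flat_exp 0 x.
Proof. by rewrite /flat_exp; case: ifP => // _; rewrite mul1r expR_ge0. Qed.

Let flat0_le1 x : flat_exp 0 x <= 1.
Proof.
rewrite /flat_exp; case: ifPn => // x0; rewrite mul1r -expR0 ler_expR oppr_le0.
by rewrite invr_ge0 ltW.
Qed.

Lemma bump_ge0 s : 0 <= bump s.
Proof. by rewrite mulr_ge0. Qed.

Lemma bump_le1 s : bump s <= 1.
Proof. by rewrite mulr_ile1. Qed.

Lemma bump_eq0 s : 1 <= `|s| -> bump s = 0.
Proof.
rewrite /bump ler_normr => /orP[h|h]; rewrite /flat_exp.
  by rewrite [X in X * _]ifF ?mul0r//; apply/negbTE; rewrite -leNgt; lra.
by rewrite [X in _ * X]ifF ?mulr0//; apply/negbTE; rewrite -leNgt; lra.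
Qed.

Lemma bump_ge s : `|s| <= 3^-1 -> expR (- 3) <= bump s.
Proof.
rewrite ler_norml => /andP[h1 h2].
have h (x : R) : 2 / 3 <= x -> expR (- (3 / 2)) <= flat_exp 0 x.
  move=> hx; have x0 : 0 < x by lra.
  rewrite /flat_exp x0 mul1r ler_expR lerN2 -[X in _ <= X]invf_div lef_pV2 ?posrE//.
rewrite (_ : - 3 = - (3 / 2) + - (3 / 2)); last by field.
rewrite expRD ler_pM ?expR_ge0//; apply: h; lra.
Qed.

Lemma bump_derive_bounded : exists2 K : R, 0 < K &
  forall s, `|'D_1 bump s| <= K.
Proof.
have [_ /(_ 1) cD] := Ck_bump 1.
have cA : compact (`[(-1), 1]%classic : set R) by exact: segment_compact.
have [M [_ gM]] : bounded_set [set ('D_1 bump x : R) | x in (`[(-1), 1]%classic : set R)].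
  by apply/compact_bounded/continuous_compact => //; exact: continuous_subspaceT.
have z s : 1 < `|s| -> 'D_1 bump s = 0.
  move=> s1; apply: derive_near0; near=> y; apply/bump_eq0/ltW; near: y.
  have cn : {for s, continuous (fun y : R => `|y|)} by exact: norm_continuous.
  exact: (cvgr_gt _ cn).
exists (`|M| + 1); first by rewrite ltr_wpDl.
move=> s; have [/z ->|s1] := ltP 1 `|s|; first by rewrite normr0 addr_ge0.
apply: gM; first by rewrite ltr_pwDr// ler_norm.
by exists s => //=; rewrite in_itv/= -ler_norml.
Unshelve. all: by end_near. Qed.

End Bump.

Section LogLift.
Context {R : realType}.

(** The function W(ln r) on r > 0. When W vanishes near -oo it is zero in a
    neighbourhood of r = 0, so that composing with |x'|^2 is harmless at x' = 0. *)
Definition log_lift (W : R -> R) (r : R) : R := if 0 < r then W (ln r) else 0.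

Let log_lift_near0 (W : R -> R) (A r : R) : (forall s, s < A -> W s = 0) -> r < expR A ->
  log_lift W r = 0.
Proof.
move=> W0 rA; rewrite /log_lift; case: ifPn => // r0; apply: W0.
by rewrite -(expRK A) ltr_ln ?posrE ?expR_gt0.
Qed.

Lemma is_derive_log_lift (W : R -> R) (A r : R) : Ck 1 W -> (forall s, s < A -> W s = 0) ->
  is_derive r (1 : R) (log_lift W) (log_lift (fun s => 'D_1 W s * expR (- s)) r).
Proof.
move=> [dW _] W0.
have [r0|r0] := ltP 0 r.
  have D : is_derive r (1 : R) (W \o @ln R) ('D_1 W (ln r) * r^-1).
    apply: is_derive1_comp; last exact: is_derive1_ln.
    by apply/derivableP/derivable1_diffP.
  have -> : log_lift (fun s => 'D_1 W s * expR (- s)) r = 'D_1 W (ln r) * r^-1.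
    by rewrite /log_lift r0 expRN lnK.
  apply: (near_eq_is_derive _ D); near=> y; rewrite /log_lift ifT//.
  by near: y; exact: lt_nbhsr.
have rA : r < expR A by apply: le_lt_trans r0 _; exact: expR_gt0.
have -> : log_lift (fun s => 'D_1 W s * expR (- s)) r = 0.
  by rewrite /log_lift ifF// ltNge r0.
have z : \forall y \near r, (cst 0 : R -> R) y = log_lift W y.
  near=> y; rewrite (log_lift_near0 _ A)//.
  by near: y; exact: lt_nbhsl.
exact: (near_eq_is_derive z (is_derive_cst _ _ _)).
Unshelve. all: by end_near. Qed.

Lemma Ck_expR k : Ck k (@expR R).
Proof.
elim: k => [|k IHk]; first exact: continuous_expR.
exact: (Ck_derive1 _ k _ _ (fun s => is_derive_expR s)).
Qed.

Lemma Ck_expR_affine k (a : R) : Ck k (fun s : R => expR (a * s)).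
Proof.
apply: Ck_ext (Ck_comp k expR _ (Ck_expR k) (Ck_affine k 0 a)) => s /=.
by rewrite add0r.
Qed.

(** The class of lifts is closed under differentiation: the derivative of W(ln r) is
    the lift of exp(-s) W'(s). *)
Lemma Ck_log_lift k (W : R -> R) (A : R) : (forall l, Ck l W) ->
  (forall s, s < A -> W s = 0) -> Ck k (log_lift W).
Proof.
elim: k W => [|k IHk] W hW W0.
  move=> r; apply/differentiable_continuous/derivable1_diffP.
  by apply: ex_derive; exact: (is_derive_log_lift _ A).
apply: (Ck_derive1 _ k _ _ (fun r => is_derive_log_lift W A r (hW 1%N) W0)).
apply: IHk => [l|s sA].
  apply: CkM; first by have [_ /(_ 1)] := hW l.+1.
  by apply: Ck_ext (Ck_expR_affine l (-1)) => s; rewrite mulN1r.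
rewrite derive_near0 ?mul0r//; near=> y; apply: W0.
by near: y; exact: lt_nbhsl.
Unshelve. all: by end_near. Qed.

End LogLift.

Lemma sqrt_sum_sqrD (R : realType) (I : finType) (y z : I -> R) :
  Num.sqrt (\sum_i (y i + z i) ^+ 2) <=
  Num.sqrt (\sum_i y i ^+ 2) + Num.sqrt (\sum_i z i ^+ 2).
Proof.
set Y := \sum_i y i ^+ 2; set Z := \sum_i z i ^+ 2.
have Y0 : 0 <= Y by apply: sumr_ge0 => i _; exact: sqr_ge0.
have Z0 : 0 <= Z by apply: sumr_ge0 => i _; exact: sqr_ge0.
rewrite -[leRHS]ger0_norm ?addr_ge0 ?sqrtr_ge0// -sqrtr_sqr ler_sqrt ?sqr_ge0//.
rewrite sqrrD !sqr_sqrtr//.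
have -> : \sum_i (y i + z i) ^+ 2 = Y + (\sum_i y i * z i) *+ 2 + Z.
  rewrite -sumrMnl /Y /Z -!big_split/=; apply: eq_bigr => i _; ring.
rewrite lerD2r lerD2l lerMn2r/=.
exact: le_trans (ler_norm _) (cauchy_schwarz_sum _ _ _).
Qed.

Section Cutoff.
Context {R : realType} {N : nat} {Ns : seq nat} (G : stratifiedGroup R N Ns).
Notation V := 'rV[R]_(N + sumn Ns).
Notation dil := (@dilation R N Ns).
Notation stratum j := (reshape_index (N :: Ns) j).

Lemma derive_dilation_coord (g : V -> R) l x j : (forall y, differentiable g y) ->
  is_derive (0 : R) (1 : R) (fun s => g (dil l (x + s *: delta_mx 0 j)))
   ('D_(delta_mx 0 j) g (dil l x) * l ^+ (stratum j).+1).
Proof.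
move=> dg.
have D := is_derive_line _ g (dil l x) (delta_mx 0 j) 0 (dg _).
rewrite scale0r addr0 in D.
have D1 : is_derive (0 : R) (1 : R)
   ((fun s : R => g (dil l x + s *: delta_mx 0 j)) \o (fun s => l ^+ (stratum j).+1 * s))
   ('D_(delta_mx 0 j) g (dil l x) * (l ^+ (stratum j).+1 *: 1)).
  by apply: is_derive1_comp; rewrite mulr0.
rewrite (_ : (fun s => _) = (fun s : R => g (dil l x + s *: delta_mx 0 j)) \o
    (fun s => l ^+ (stratum j).+1 * s)).
  by apply: is_derive_eq D1 _; rewrite /GRing.scale/= mulr1.
by apply/funext => s /=; rewrite dilationD_delta.
Qed.

(** Coordinatewise, l^(d_j) a_kj(x) = l a_kj(delta_l x), where d_j is the degree of
    the j-th coordinate. *)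
Lemma sg_X_derive_dilation k (g : V -> R) l x : 0 < l -> Ck 1 g -> Ck 1 (g \o dil l) ->
  'D_(sg_X G k x) (g \o dil l) x = l * 'D_(sg_X G k (dil l x)) g (dil l x).
Proof.
move=> l0 [dg _] [dgl _].
rewrite !derive_sum_coord// mulr_sumr; apply: eq_bigr => j _.
rewrite sg_X_homogeneous//.
have D := is_derive_line _ (g \o dil l) x (delta_mx 0 j) 0 (dgl _).
have := @derive_val _ _ _ _ _ _ _ D; rewrite scale0r addr0 => <-.
rewrite (@derive_val _ _ _ _ _ _ _ (derive_dilation_coord g l x j dg)).
by rewrite exprS; ring.
Qed.

(** A cutoff in the higher strata only, at homogeneous scale 1/l. *)
Definition layer_cutoff (l : R) (x : V) : R :=
  \prod_(j < sumn Ns) bump (dil l x 0 (rshift N j) / 3).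

Lemma Ck_layer_cutoff k l : Ck k (layer_cutoff l).
Proof.
apply: Ck_prod => j.
pose q : V -> R := fun x => x 0 (rshift N j).
apply: Ck_ext (Ck_comp k (bump \o fun s => 0 + (l ^+ (stratum (rshift N j)).+1 / 3) * s)
  q _ (Ck_coord _ _ _ _)).
  by move=> x /=; congr bump; rewrite add0r mxE /q; ring.
by apply: Ck_comp; [exact: Ck_bump|exact: Ck_affine].
Qed.

Lemma dilation1 (x : V) : dil 1 x = x.
Proof. by apply/rowP => j; rewrite mxE expr1n mul1r. Qed.

Lemma layer_cutoffE l : layer_cutoff l = layer_cutoff 1 \o dil l.
Proof. by apply/funext => x; rewrite /layer_cutoff /= dilation1. Qed.

Lemma layer_cutoff_eq0 l x j : 3 <= `|dil l x 0 (rshift N j)| -> layer_cutoff l x = 0.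
Proof.
move=> h; rewrite /layer_cutoff (bigD1 j)//= bump_eq0 ?mul0r//.
by rewrite normrM [X in _ * X]ger0_norm ?invr_ge0// ler_pdivlMr// mul1r.
Qed.

Lemma layer_cutoff_ge0 l x : 0 <= layer_cutoff l x.
Proof. by apply: prodr_ge0 => j _; exact: bump_ge0. Qed.

Lemma layer_cutoff_le1 l x : layer_cutoff l x <= 1.
Proof.
have h : layer_cutoff l x <= \prod_(j < sumn Ns) (1 : R).
  by apply: ler_prod => j _; rewrite bump_ge0 bump_le1.
by rewrite big1_eq in h.
Qed.

Lemma hgrad_continuous (g : V -> R) : Ck 1 g ->
  continuous (fun x => Num.sqrt (\sum_k 'D_(sg_X G k x) g x ^+ 2)).
Proof.
move=> g1 x.
apply: (@continuous_comp _ _ _ (fun x => \sum_k ('D_(sg_X G k x) g x ^+ 2)) Num.sqrt);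
  last exact: sqrt_continuous.
have cS : Ck 0 (fun x => \sum_k ('D_(sg_X G k x) g x ^+ 2)).
  by apply: Ck_sum => k; apply: (CkM 0%N); exact: continuous_sg_X_derive.
exact: cS.
Qed.

(** By homogeneity this is the case l = 1 evaluated at delta_l x, a point of a fixed
    compact cube. The condition on the first stratum is needed for that: the
    coefficients of X_k may grow with x'. *)
Lemma layer_cutoff_hgrad_bound : exists2 A : R, 0 < A & forall l x, 0 < l ->
  (forall k, `|dil l x 0 (lshift (sumn Ns) k)| <= 1) ->
  (forall j, `|dil l x 0 (rshift N j)| <= 3) ->
  Num.sqrt (\sum_k 'D_(sg_X G k x) (layer_cutoff l) x ^+ 2) <= A * l.
Proof.
have c1 := Ck_layer_cutoff 1 1.
have cG := hgrad_continuous _ c1.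
have cB : compact [set x : V | `|x| <= 3].
  apply: bounded_closed_compact.
    by exists 3; split; [exact: num_real|move=> M KM x /= /le_trans; apply; exact: ltW].
  apply: (@closed_comp _ _ (fun x : V => `|x|) [set y | y <= 3]) => //.
  by move=> x _; exact: norm_continuous.
have [M [_ gM]] : bounded_set [set Num.sqrt (\sum_k 'D_(sg_X G k x) (layer_cutoff 1) x ^+ 2)
    | x in [set x : V | `|x| <= 3]].
  by apply/compact_bounded/continuous_compact => //; exact: continuous_subspaceT.
exists (`|M| + 1); first by rewrite ltr_wpDl.
move=> l x l0 h1 h2.
have cl : Ck 1 (layer_cutoff 1 \o dil l) by rewrite -layer_cutoffE; exact: Ck_layer_cutoff.
have E k : 'D_(sg_X G k x) (layer_cutoff l) x =
    l * 'D_(sg_X G k (dil l x)) (layer_cutoff 1) (dil l x).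
  by rewrite (layer_cutoffE l); exact: sg_X_derive_dilation.
under eq_bigr do rewrite E exprMn.
rewrite -mulr_sumr sqrtrM ?sqr_ge0// sqrtr_sqr (gtr0_norm l0).
rewrite mulrC ler_wpM2r ?(ltW l0)//.
rewrite -[leLHS]ger0_norm ?sqrtr_ge0//.
apply: gM; first by rewrite ltr_pwDr// ler_norm.
exists (dil l x) => //=; rewrite rV_norm_le//; apply/forallP => j.
case: (split_ordP j) => [k ->|k ->] //.
by apply: (le_trans (h1 k)); rewrite ler1n.
Qed.

End Cutoff.

(** * Near-extremal functions *)

Section NearExtremal.
Context {R : realType} {N : nat} {Ns : seq nat} (G : stratifiedGroup R N Ns).
Notation V := 'rV[R]_(N + sumn Ns).
Notation dil := (@dilation R N Ns).
Variables (p T : R).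
Hypotheses (p1 : 1 < p) (T1 : 1 <= T).

Let gam := (p - N%:R) / p.
Let W (s : R) : R := expR (gam / 2 * s) * bump ((3 * T)^-1 * s).
Let S := T * expR (3 / 2 * T).
Let l := S^-1.

(** The profile is W(ln |x'|^2): the power |x'|^((p - N) / p), which formally gives
    equality in the Hardy inequality, cut off at logarithmic scale T. The cutoff in
    the higher strata is at scale S, so large that |x'| / S <= 1/T on the support of
    the first one. *)
Definition near_extremal_re (x : V) : R := log_lift W (hsq x) * layer_cutoff l x.
Definition near_extremal (x : V) : R[i] := Complex (near_extremal_re x) 0.

Let p0 : 0 < p. Proof. exact: lt_trans p1. Qed.
Let T0 : 0 < T. Proof. exact: lt_le_trans T1. Qed.
Let S0 : 0 < S. Proof. by rewrite mulr_gt0// expR_gt0. Qed.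
Let l0 : 0 < l. Proof. by rewrite invr_gt0. Qed.
Let T30 : 0 < 3 * T. Proof. by rewrite mulr_gt0. Qed.

Let W_smooth k : Ck k W.
Proof.
apply: CkM; first exact: Ck_expR_affine.
apply: Ck_ext (Ck_comp k bump _ (Ck_bump k) (Ck_affine k 0 (3 * T)^-1)) => s /=.
by rewrite add0r.
Qed.

Let W_eq0 s : 3 * T <= `|s| -> W s = 0.
Proof.
move=> h; rewrite /W bump_eq0 ?mulr0//.
by rewrite normrM ger0_norm ?invr_ge0 ?(ltW T30)// mulrC ler_pdivlMr// mul1r.
Qed.

Let W_low s : s < - (3 * T) -> W s = 0.
Proof. by move=> h; apply: W_eq0; rewrite ler_normr; apply/orP; right; lra. Qed.

Lemma near_extremal_smooth k : Ck k near_extremal_re.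
Proof.
apply: CkM; last exact: Ck_layer_cutoff.
apply: (Ck_comp k (log_lift W) hsq); last exact: Ck_hsq.
exact: (Ck_log_lift k W (- (3 * T))).
Qed.

Definition near_extremal_box (x : V) : bool :=
  (expR (- (3 * T)) <= hsq x <= expR (3 * T)) &&
  [forall j, `|dil l x 0 (rshift N j)| <= 3].

Let log_lift_eq0 r : ~~ (expR (- (3 * T)) <= r <= expR (3 * T)) -> log_lift W r = 0.
Proof.
move=> h; rewrite /log_lift; case: ifPn => // r0; apply: W_eq0.
move: h; apply: contraNT; rewrite -ltNge ltr_norml => /andP[h1 h2].
have rE : r = expR (ln r) by rewrite lnK.
by rewrite rE !ler_expR ltW//= ltW.
Qed.

Lemma near_extremal_eq0 x : ~~ near_extremal_box x -> near_extremal_re x = 0.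
Proof.
rewrite negb_and => /orP[/log_lift_eq0|/forallPn[j]].
  by rewrite /near_extremal_re => ->; rewrite mul0r.
rewrite -ltNge => /ltW h.
by rewrite /near_extremal_re (layer_cutoff_eq0 l x j)// mulr0.
Qed.

Lemma closed_near_extremal_box : closed [set x | near_extremal_box x].
Proof.
rewrite (_ : [set x | near_extremal_box x] =
   (hsq @^-1` `[expR (- (3 * T)), expR (3 * T)]%classic) `&`
   \bigcap_(j in [set: 'I_(sumn Ns)])
    ((fun x : V => `|dil l x 0 (rshift N j)|) @^-1` [set y | y <= 3])); last first.
  apply/seteqP; split => x /=.
    move=> /andP[h1 /forallP h2]; split; first by rewrite in_itv.
    by move=> j _; exact: h2.
  move=> [h1 h2]; apply/andP; split; first by rewrite in_itv in h1.
  by apply/forallP => j; exact: h2.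
apply: closedI.
  apply: closed_comp; last exact: itv_closed.
  by move=> x _; exact: (Ck_continuous 0%N _ (Ck_hsq 0%N)).
apply: closed_bigI => j _.
apply: closed_comp; last exact: closed_le.
move=> x _.
apply: (@continuous_comp _ _ _ (fun x : V => dil l x 0 (rshift N j)) (fun y : R => `|y|));
  last exact: norm_continuous.
have -> : (fun x : V => dil l x 0 (rshift N j)) =
  (fun x : V => l ^+ (reshape_index (N :: Ns) (rshift N j)).+1 * x 0 (rshift N j)).
  by apply/funext => y; rewrite mxE.
by apply: (CkM 0%N (fun=> _)); [exact: Ck_cst|exact: Ck_coord].
Qed.

Lemma near_extremal_box_bounded : exists K, forall x, near_extremal_box x -> `|x| <= K.
Proof.
pose K := Num.sqrt (expR (3 * T)) +
  \sum_(j < sumn Ns) 3 / l ^+ (reshape_index (N :: Ns) (rshift N j)).+1.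
have s0 : 0 <= \sum_(j < sumn Ns) 3 / l ^+ (reshape_index (N :: Ns) (rshift N j)).+1.
  by apply: sumr_ge0 => j _; rewrite divr_ge0// exprn_ge0// ltW.
exists K => x /andP[/andP[_ qx] /forallP h]; rewrite rV_norm_le ?addr_ge0 ?sqrtr_ge0//.
apply/forallP => j; case: (split_ordP j) => [k ->|k ->].
  apply: (@le_trans _ _ (Num.sqrt (expR (3 * T)))); last by rewrite lerDl.
  rewrite -sqrtr_sqr ler_sqrt ?expR_ge0//; apply: le_trans qx.
  by rewrite /hsq (bigD1 k)//= lerDl sumr_ge0// => i _; exact: sqr_ge0.
apply: (@le_trans _ _ (3 / l ^+ (reshape_index (N :: Ns) (rshift N k)).+1)).
  have := h k; rewrite mxE normrM gtr0_norm ?exprn_gt0// mulrC.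
  by rewrite -ler_pdivlMr// exprn_gt0.
rewrite /K (bigD1 k)//= addrCA lerDl addr_ge0 ?sqrtr_ge0//.
by apply: sumr_ge0 => j' _; rewrite divr_ge0// exprn_ge0// ltW.
Qed.

Lemma near_extremal_test : test_function (@first_stratum_neq0 R N Ns) near_extremal.
Proof.
have sB : csupport near_extremal `<=` [set x | near_extremal_box x].
  rewrite (closure_id [set x | near_extremal_box x]).1; last exact: closed_near_extremal_box.
  apply: closure_subset => x /=; apply: contraNT => /near_extremal_eq0 h.
  by rewrite /near_extremal h.
split.
- by move=> k; exact: near_extremal_smooth.
- by move=> k; exact: Ck_cst.
- apply: bounded_closed_compact; last exact: closed_closure.
  have [K hK] := near_extremal_box_bounded.
  exists K; split; first exact: num_real.
  by move=> M KM x /sB /hK /le_trans; apply; exact: ltW.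
- move=> x /sB /andP[/andP[qx _] _]; rewrite /first_stratum_neq0/=.
  apply/eqP => lx; move: qx; rewrite leNgt => /negP; apply.
  rewrite (_ : hsq x = 0) ?expR_gt0//.
  rewrite /hsq big1// => k _; have := congr1 (fun y : 'rV[R]_N => y 0 k) lx.
  by rewrite !mxE => ->; rewrite expr0n.
Qed.

(** This is |x'|^(-N/p); its p-th power is a density invariant under scalings of
    x'. *)
Definition critical_weight (x : V) : R := hsq x `^ ((gam - 1) / 2).
Notation w := critical_weight.

Let pow_gam q : 0 < q -> expR (gam / 2 * ln q) = q `^ (gam / 2).
Proof. by move=> q0; rewrite /powR gt_eqF. Qed.

Let pow_gamB q : 0 < q -> q `^ (gam / 2) = q `^ ((gam - 1) / 2) * Num.sqrt q.
Proof.
move=> q0; rewrite -powR12_sqrt ?(ltW q0)// -powRD ?(gt_eqF q0) ?implybT//.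
by congr (_ `^ _); field.
Qed.

Let WE q : 0 < q -> W (ln q) = q `^ ((gam - 1) / 2) * Num.sqrt q * bump ((3 * T)^-1 * ln q).
Proof. by move=> q0; rewrite /W pow_gam// pow_gamB. Qed.

Lemma near_extremal_modulus x : 0 < hsq x -> cmod (hardy_quotient near_extremal x) =
  w x * (bump ((3 * T)^-1 * ln (hsq x)) * layer_cutoff l x).
Proof.
move=> q0; rewrite cmod_hardy_quotient/= expr0n addr0 sqrtr_sqr.
rewrite /near_extremal_re /log_lift q0 WE// -/(w x).
have r0 : 0 < Num.sqrt (hsq x) by rewrite sqrtr_gt0.
rewrite ger0_norm; last first.
  apply: mulr_ge0; last exact: layer_cutoff_ge0.
  by apply: mulr_ge0; [rewrite mulr_ge0 ?powR_ge0 ?sqrtr_ge0|exact: bump_ge0].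
by field; rewrite gt_eqF.
Qed.

Let derive_W s : 'D_1 W s = expR (gam / 2 * s) *
  (gam / 2 * bump ((3 * T)^-1 * s) + (3 * T)^-1 * 'D_1 bump ((3 * T)^-1 * s)).
Proof.
have D1 : is_derive s (1 : R) (@expR R \o (fun s => gam / 2 * s))
    (expR (gam / 2 * s) * (gam / 2 *: 1)).
  by apply: is_derive1_comp.
have D2 : is_derive s (1 : R) (bump \o (fun s => (3 * T)^-1 * s))
    ('D_1 bump ((3 * T)^-1 * s) * ((3 * T)^-1 *: 1)).
  apply: is_derive1_comp; apply/derivableP/derivable1_diffP.
  by have [db _] := Ck_bump (R := R) 1; exact: db.
rewrite (@derive_val _ _ _ _ _ _ _ (is_deriveM D1 D2)) /GRing.scale/= !mulr1.
by ring.
Qed.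

(** Differentiating the power gives the main term. A derivative that falls on the
    logarithmic cutoff costs 1/T, one that falls on the layer cutoff costs
    |x'| / S <= 1/T. *)
Lemma near_extremal_hgrad (K A : R) (x : V) :
  (forall s, `|'D_1 (bump : R -> R) s| <= K) ->
  (forall l x, 0 < l ->
    (forall k, `|dil l x 0 (lshift (sumn Ns) k)| <= 1) ->
    (forall j, `|dil l x 0 (rshift N j)| <= 3) ->
    Num.sqrt (\sum_k 'D_(sg_X G k x) (layer_cutoff l) x ^+ 2) <= A * l) ->
  cenorm (hgrad G near_extremal x) <=
  `|N%:R - p| / p * cmod (hardy_quotient near_extremal x) +
  (K + A) / T * (w x * (near_extremal_box x)%:R).
Proof.
move=> bK cA.
have K0 : 0 <= K by exact: le_trans (bK 0).
have -> : cenorm (hgrad G near_extremal x) =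
    Num.sqrt (\sum_k 'D_(sg_X G k x) near_extremal_re x ^+ 2).
  rewrite cenorm_hgrad; congr Num.sqrt; apply: eq_bigr => k _ /=.
  by rewrite derive_cst expr0n addr0.
have c0 : 0 <= `|N%:R - p| / p by rewrite divr_ge0// ltW.
have [bx|nbx] := boolP (near_extremal_box x); last first.
  rewrite !mulr0 addr0 big1 => [|k _].
    by rewrite sqrtr0; apply: mulr_ge0; [exact: c0|exact: cmod_ge0].
  have : \forall y \near x, near_extremal_re y = 0.
    have : nbhs x (~` [set y | near_extremal_box y]).
      by apply: open_nbhs_nbhs; split; [exact/closed_openC/closed_near_extremal_box|exact/negP].
    by apply: filterS => y /negP; exact: near_extremal_eq0.
  by move=> /(derive_near0 _ _ _ (sg_X G k x)) ->; rewrite expr0n.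
have [/andP[qlo qhi] /forallP hx] := andP bx.
have q0 : 0 < hsq x by apply: lt_le_trans qlo; exact: expR_gt0.
set r := Num.sqrt (hsq x).
have r0 : 0 < r by rewrite sqrtr_gt0.
have rhi : r <= expR (3 / 2 * T).
  rewrite -[leRHS]ger0_norm ?expR_ge0// -sqrtr_sqr ler_sqrt ?sqr_ge0//.
  by rewrite -expRM_natl (_ : 2%:R * (3 / 2 * T) = 3 * T)//; field.
have rl : r * l <= T^-1.
  rewrite /l /S invfM mulrCA ler_piMr ?invr_ge0 ?(ltW T0)//.
  by rewrite ler_pdivrMr ?expR_gt0// mul1r.
have w0 : 0 <= w x by exact: powR_ge0.
pose U := log_lift W (hsq x).
pose P := layer_cutoff l x.
pose b := bump ((3 * T)^-1 * ln (hsq x)).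
pose b' := 'D_1 (bump : R -> R) ((3 * T)^-1 * ln (hsq x)).
have UE : U = w x * r * b by rewrite /U /log_lift q0 WE.
have P0 : 0 <= P by exact: layer_cutoff_ge0.
have P1 : P <= 1 by exact: layer_cutoff_le1.
have b0 : 0 <= b by exact: bump_ge0.
have b1 : b <= 1 by exact: bump_le1.
pose c := w x * (gam * b + 2 / (3 * T) * b') / r.
have DE k : 'D_(sg_X G k x) near_extremal_re x =
    U * 'D_(sg_X G k x) (layer_cutoff l) x + P * c * x 0 (lshift (sumn Ns) k).
  have [dq _] := Ck_hsq 1%N (R := R) (N := N) (Ns := Ns).
  have [dL _] := Ck_layer_cutoff 1%N l (R := R) (N := N) (Ns := Ns).
  have [dc Dc] := derive_comp1 _ hsq (log_lift W) x (sg_X G k x) _ (dq x)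
    (is_derive_log_lift W (- (3 * T)) (hsq x) (W_smooth 1%N) W_low).
  rewrite [LHS](deriveM (f := log_lift W \o hsq) (g := layer_cutoff l)); try exact: diff_derivable.
  rewrite Dc derive_hsq /GRing.scale/= -/U -/P; congr (_ + _).
  rewrite -mulrA; congr (_ * _).
  rewrite /log_lift q0 derive_W expRN lnK ?posrE// -/b -/b' pow_gam// pow_gamB// -/(w x) -/r /c.
  have -> : hsq x = r ^+ 2 by rewrite sqr_sqrtr// ltW.
  by field; rewrite !gt_eqF.
under eq_bigr do rewrite DE.
apply: (le_trans (sqrt_sum_sqrD _ _ _ _)).
have sqrtZ (a : R) (F : 'I_N -> R) : Num.sqrt (\sum_k (a * F k) ^+ 2) =
    `|a| * Num.sqrt (\sum_k F k ^+ 2).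
  under eq_bigr do rewrite exprMn.
  by rewrite -mulr_sumr sqrtrM ?sqr_ge0// sqrtr_sqr.
rewrite !sqrtZ -/(hsq x) -/r.
have h1 : `|U| * Num.sqrt (\sum_k 'D_(sg_X G k x) (layer_cutoff l) x ^+ 2) <= A / T * w x.
  have hA : Num.sqrt (\sum_k 'D_(sg_X G k x) (layer_cutoff l) x ^+ 2) <= A * l.
    apply: cA => // k; rewrite mxE stratum_lshift expr1 normrM (gtr0_norm l0).
    have xr : `|x 0 (lshift (sumn Ns) k)| <= r.
      rewrite -sqrtr_sqr ler_sqrt ?hsq_ge0// /hsq (bigD1 k)//= lerDl.
      by apply: sumr_ge0 => i _; exact: sqr_ge0.
    apply: (le_trans (ler_wpM2l (ltW l0) xr)); rewrite mulrC.
    by apply: (le_trans rl); rewrite invf_le1.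
  have A0 : 0 <= A by have := le_trans (sqrtr_ge0 _) hA; rewrite pmulr_lge0.
  apply: (le_trans (ler_wpM2l (normr_ge0 _) hA)).
  have wr0 : 0 <= w x * r by rewrite mulr_ge0 ?(ltW r0).
  rewrite UE ger0_norm; last exact: mulr_ge0.
  rewrite (_ : _ * (A * l) = A * w x * (r * l) * b); last by ring.
  rewrite (_ : A / T * w x = A * w x * T^-1 * 1); last by ring.
  have Aw0 : 0 <= A * w x by exact: mulr_ge0.
  have rl0 : 0 <= r * l by rewrite mulr_ge0 ?(ltW r0) ?(ltW l0).
  apply: ler_pM => //; first exact: mulr_ge0.
  exact: ler_wpM2l.
have h2 : `|P * c| * r <= `|N%:R - p| / p * (w x * (b * P)) + K / T * w x.
  have -> : `|P * c| * r = P * w x * `|gam * b + 2 / (3 * T) * b'|.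
    rewrite -[X in _ * X = _](gtr0_norm r0) -normrM.
    have -> : P * c * r = P * w x * (gam * b + 2 / (3 * T) * b').
      by rewrite /c; field; rewrite !gt_eqF.
    by rewrite normrM ger0_norm// mulr_ge0.
  have gE : `|gam| = `|N%:R - p| / p by rewrite /gam normrM normfV (gtr0_norm p0) distrC.
  have h3 : `|gam * b + 2 / (3 * T) * b'| <= `|N%:R - p| / p * b + K / T.
    apply: (le_trans (ler_normD _ _)); rewrite (normrM gam) (normrM _ b') gE (ger0_norm b0) lerD2l.
    rewrite ger0_norm ?divr_ge0 ?(ltW T30)//.
    apply: (@le_trans _ _ (2 / (3 * T) * K)).
      by rewrite ler_wpM2l ?divr_ge0 ?(ltW T30)//; exact: bK.
    rewrite mulrC ler_wpM2l// ler_pdivrMr//.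
    by rewrite mulrCA mulVf ?gt_eqF// mulr1 ler_nat.
  apply: (le_trans (ler_wpM2l _ h3)); first by rewrite mulr_ge0.
  rewrite mulrDr (_ : P * w x * (`|N%:R - p| / p * b) =
    `|N%:R - p| / p * (w x * (b * P))); last by ring.
  rewrite lerD2l (mulrC (P * _)) ler_wpM2l ?divr_ge0 ?(ltW T0)//.
  by rewrite ler_piMl.
rewrite near_extremal_modulus// -/b -/P mulr1.
apply: (le_trans (lerD h1 h2)).
rewrite (_ : (K + A) / T * w x = A / T * w x + K / T * w x); last by ring.
by rewrite addrCA.
Qed.

End NearExtremal.

(** * Scale invariance of the critical weight *)

Section Shells.
Context {R : realType} {N : nat} {Ns : seq nat}.
Notation V := 'rV[R]_(N + sumn Ns).
Notation tupR := ((N + sumn Ns).-tuple (measurableTypeR R)).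
Notation dil := (@dilation R N Ns).
Notation mu := (lebesgue_tuple R (N + sumn Ns)).
Notation rv := (@rV_of_tuple R (N + sumn Ns)).
Variable l : R.

Definition shell (lo hi s : R) (x : V) : bool :=
  (lo <= hsq x <= hi) && [forall j, `|dil l x 0 (rshift N j)| <= s].

Definition shell_weight (lo hi s : R) (x : V) : R :=
  hsq x `^ (- (N%:R / 2)) * (shell lo hi s x)%:R.

Lemma measurable_shell lo hi s :
  measurable_fun [set: tupR] (fun t => (shell lo hi s (rv t))%:R : R).
Proof.
have mq : measurable_fun [set: tupR] (fun t => hsq (rv t)).
  exact: (continuous_measurable_tuple _ hsq (Ck_continuous 0%N _ (Ck_hsq 0%N))).
pose A := [set t : tupR | shell lo hi s (rv t)].
have mA : measurable A.
  have -> : A = ((fun t => lo <= hsq (rv t)) @^-1` [set true]) `&`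
     ((fun t => hsq (rv t) <= hi) @^-1` [set true]) `&`
     \bigcap_(j in [set: 'I_(sumn Ns)])
       ((fun t => `|dil l (rv t) 0 (rshift N j)| <= s) @^-1` [set true]).
    apply/seteqP; split => t /=.
      move=> /andP[/andP[h1 h2] /forallP h3]; split; first by split.
      by move=> j _; exact: h3.
    move=> [[h1 h2] h3]; rewrite /A/= /shell h1 h2/=; apply/forallP => j.
    exact: (h3 j I).
  apply: measurableI.
    apply: measurableI; rewrite -[X in measurable X]setTI.
      by apply: measurable_fun_ler.
    by apply: measurable_fun_ler.
  apply: fin_bigcap_measurable => // j _; rewrite -[X in measurable X]setTI.
  apply: measurable_fun_ler => //; apply: measurableT_comp => //.
  under eq_fun do rewrite mxE mxE.
  apply: measurable_funM => //; exact: measurable_tnth.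
have -> : (fun t => (shell lo hi s (rv t))%:R : R) = \1_A.
  by apply/funext => t; rewrite indicE; congr (_%:R); congr nat_of_bool; rewrite mem_setE.
exact: measurable_indic.
Qed.

Lemma measurable_shell_weight lo hi s :
  measurable_fun [set: tupR] (fun t => shell_weight lo hi s (rv t)).
Proof.
apply: measurable_funM; last exact: measurable_shell.
apply: (measurableT_comp (measurable_powR _)).
exact: (continuous_measurable_tuple _ hsq (Ck_continuous 0%N _ (Ck_hsq 0%N))).
Qed.

Lemma shell_weight_ge0 lo hi s x : 0 <= shell_weight lo hi s x.
Proof. by rewrite mulr_ge0 ?powR_ge0. Qed.

Let layer_scale (a : R) (i : 'I_(N + sumn Ns)) : R :=
  match fintype.split i with inl _ => a | inr _ => 3^-1 end.

Let rv_layer_scale_l a t k : rv (tscale _ (layer_scale a) t) 0 (lshift (sumn Ns) k) =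
  a * rv t 0 (lshift (sumn Ns) k).
Proof. by rewrite !mxE tnth_mktuple /layer_scale (unsplitK (inl k)). Qed.

Let rv_layer_scale_r a t j : rv (tscale _ (layer_scale a) t) 0 (rshift N j) =
  3^-1 * rv t 0 (rshift N j).
Proof. by rewrite !mxE tnth_mktuple /layer_scale (unsplitK (inr j)). Qed.

(** The density |x'|^(-N) is invariant under x' |-> a x', while the scaling by 1/3 of
    the higher layers contributes its Jacobian. *)
Lemma shell_weight_scale a lo hi : 0 < a ->
  (\int[mu]_t (shell_weight (lo / a ^+ 2) (hi / a ^+ 2) 3 (rv t))%:E =
   (3 ^+ sumn Ns)%:E * \int[mu]_t (shell_weight lo hi 1 (rv t))%:E)%E.
Proof.
move=> a0; have a20 : 0 < a ^+ 2 by rewrite exprn_gt0.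
have E t : shell_weight lo hi 1 (rv (tscale _ (layer_scale a) t)) =
    a ^- N * shell_weight (lo / a ^+ 2) (hi / a ^+ 2) 3 (rv t).
  have qE : hsq (rv (tscale _ (layer_scale a) t)) = a ^+ 2 * hsq (rv t).
    by rewrite /hsq mulr_sumr; apply: eq_bigr => k _; rewrite rv_layer_scale_l exprMn.
  rewrite /shell_weight /shell qE mulrA; congr (_ * _).
    rewrite powRM ?hsq_ge0 ?(ltW a20)//; congr (_ * _).
    rewrite -powR_mulrn ?(ltW a0)// -powRrM -powR_invn ?(ltW a0)//.
    by congr (_ `^ _); field.
  congr (nat_of_bool _)%:R; congr (_ && _).
    by rewrite ler_pdivrMr// ler_pdivlMr// (mulrC (a ^+ 2)).
  apply: eq_forallb => j; rewrite !mxE -[tnth _ _]/(_).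
  have := rv_layer_scale_r a t j; rewrite !mxE => ->.
  rewrite mulrCA normrM ger0_norm ?invr_ge0// mulrC ler_pdivrMr// mul1r.
  by [].
have mF : measurable_fun [set: tupR] (fun t => (shell_weight lo hi 1 (rv t))%:E).
  by apply/measurable_EFinP; exact: measurable_shell_weight.
have ls i : 0 < layer_scale a i by rewrite /layer_scale; case: fintype.split.
have mB : measurable_fun [set: tupR]
    (fun t => (shell_weight (lo / a ^+ 2) (hi / a ^+ 2) 3 (rv t))%:E).
  by apply/measurable_EFinP; exact: measurable_shell_weight.
rewrite [in RHS](lebesgue_tuple_scale _ (layer_scale a) _ ls mF); last first.
  by move=> t; rewrite lee_fin shell_weight_ge0.
under [in RHS]eq_integral do rewrite E EFinM.
rewrite ge0_integralZl//; last 2 first.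
- by move=> t _; rewrite lee_fin shell_weight_ge0.
- by rewrite lee_fin invr_ge0 exprn_ge0// ltW.
rewrite !muleA -!EFinM big_split_ord/=.
have -> : \prod_(i < N) layer_scale a (lshift (sumn Ns) i) = a ^+ N.
  rewrite -[in RHS](card_ord N) -prodr_const; apply: eq_bigr => k _.
  by rewrite /layer_scale (unsplitK (inl k)).
have -> : \prod_(i < sumn Ns) layer_scale a (rshift N i) = 3^-1 ^+ sumn Ns.
  rewrite -[in RHS](card_ord (sumn Ns)) -prodr_const; apply: eq_bigr => k _.
  by rewrite /layer_scale (unsplitK (inr k)).
rewrite (_ : _ * _ * _ = 1) ?mul1e//.
have aN : a ^+ N != 0 by rewrite expf_neq0// gt_eqF.
have tN : (3 : R) ^+ sumn Ns != 0 by rewrite expf_neq0.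
by rewrite exprVn; field; rewrite aN tN.
Qed.

(** In the variable ln |x'|^2 the large shell is covered by three translates of the
    small one, centred at -2T, 0 and 2T. Each of them, with layers three times as
    wide, has mass 3^(sumn Ns) times that of the small shell. *)
Lemma shell_weight_covering (T : R) : 0 < T ->
  (\int[mu]_t (shell_weight (expR (- (3 * T))) (expR (3 * T)) 3 (rv t))%:E <=
   (3 * 3 ^+ sumn Ns)%:E *
   \int[mu]_t (shell_weight (expR (- T)) (expR T) 1 (rv t))%:E)%E.
Proof.
move=> T0.
pose J (i : R) : \bar R := (\int[mu]_t
  (shell_weight (expR (2 * i * T - T)) (expR (2 * i * T + T)) 3 (rv t))%:E)%E.
set J0 := (\int[mu]_t (shell_weight (expR (- T)) (expR T) 1 (rv t))%:E)%E.
have E i : J i = ((3 ^+ sumn Ns)%:E * J0)%E.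
  have a2 : expR (- (i * T)) ^+ 2 = expR (- (2 * i * T)).
    by rewrite -expRM_natl; congr expR; ring.
  have := shell_weight_scale (expR (- (i * T))) (expR (- T)) (expR T) (expR_gt0 _).
  rewrite a2 -!expRN opprK -!expRD => H; rewrite /J0 -H.
  apply: eq_integral => t _.
  by congr (shell_weight (expR _) _ _ _)%:E; [ring|congr expR; ring].
have -> : ((3 * 3 ^+ sumn Ns)%:E * J0 = J (-1)%R + (J 0%R + J 1%R))%E.
  rewrite !E -!ge0_muleDl ?lee_fin ?exprn_ge0// -?EFinD.
  by congr (_%:E * _)%E; ring.
have m lo hi s : measurable_fun [set: tupR] (fun t => (shell_weight lo hi s (rv t))%:E).
  by apply/measurable_EFinP; exact: measurable_shell_weight.
have g lo hi s t : (0 <= (shell_weight lo hi s (rv t))%:E)%E.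
  by rewrite lee_fin shell_weight_ge0.
have gD lo hi lo' hi' s t :
    (0 <= (shell_weight lo hi s (rv t))%:E + (shell_weight lo' hi' s (rv t))%:E)%E.
  by rewrite adde_ge0.
have mD lo hi lo' hi' s : measurable_fun [set: tupR] (fun t =>
    (shell_weight lo hi s (rv t))%:E + (shell_weight lo' hi' s (rv t))%:E)%E.
  exact: emeasurable_funD.
rewrite /J -!ge0_integralD//.
apply: ge0_le_integral => //.
- by apply: emeasurable_funD => //; exact: emeasurable_funD.
move=> t _; rewrite -!EFinD lee_fin /shell_weight -!mulrDr ler_wpM2l ?powR_ge0//.
rewrite /shell; set b := [forall j, _]; set q := hsq _.
case: b; rewrite ?andbF ?andbT ?addr0//.
rewrite (_ : 2 * -1 * T - T = - (3 * T)); last by ring.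
rewrite (_ : 2 * -1 * T + T = - T); last by ring.
rewrite (_ : 2 * 0 * T - T = - T); last by ring.
rewrite (_ : 2 * 0 * T + T = T); last by ring.
rewrite (_ : 2 * 1 * T - T = T); last by ring.
rewrite (_ : 2 * 1 * T + T = 3 * T); last by ring.
have [h|] := boolP (expR (- (3 * T)) <= q <= expR (3 * T)); last by rewrite !addr_ge0.
have /andP[h1 h2] := h.
rewrite h1 h2 /= andbT.
have [qa|qa] := leP q (expR (- T)); first by rewrite lerDl addr_ge0.
have [qb|qb] := leP q (expR T); first by rewrite (ltW qa) /= add0r lerDl.
by rewrite (ltW qb)/= addrA lerDr addr_ge0.
Qed.

End Shells.

(** * Sharpness *)

Section LpTools.
Context {R : realType}.
Variables (n : nat) (p : R).
Hypothesis p0 : 0 < p.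
Notation rv := (@rV_of_tuple R n).
Notation mu := (lebesgue_tuple R n).

Let int_ge0 (g : 'rV[R]_n -> R) : (0 <= \int[mu]_t (g (rv t) `^ p)%:E)%E.
Proof. by apply: integral_ge0 => t _; rewrite lee_fin powR_ge0. Qed.

Lemma Lpnorm_le_scale (c : R) (f g : 'rV[R]_n -> R) : 0 <= c ->
  (forall x, 0 <= f x) -> (forall x, 0 <= g x) ->
  (\int[mu]_t (f (rv t) `^ p)%:E <= (c `^ p)%:E * \int[mu]_t (g (rv t) `^ p)%:E)%E ->
  (Lpnorm p f <= c%:E * Lpnorm p g)%E.
Proof.
move=> c0 f0 g0 h; rewrite !LpnormE//.
have -> : c%:E = ((c `^ p)%:E `^ p^-1)%E.
  by rewrite poweR_EFin -powRrM mulfV ?gt_eqF// powRr1.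
rewrite -poweRM ?lee_fin ?powR_ge0//.
apply: gt0_ler_poweR => //; rewrite ?in_itv/= ?leey ?andbT ?invr_ge0 ?(ltW p0)//.
by rewrite mule_ge0// lee_fin powR_ge0.
Qed.

Lemma Lpnorm_le (f g : 'rV[R]_n -> R) :
  measurable_fun [set: n.-tuple (measurableTypeR R)] (fun t => f (rv t)) ->
  measurable_fun [set: n.-tuple (measurableTypeR R)] (fun t => g (rv t)) ->
  (forall x, 0 <= f x) -> (forall x, f x <= g x) -> (Lpnorm p f <= Lpnorm p g)%E.
Proof.
move=> mf mg f0 fg; have g0 x : 0 <= g x by exact: le_trans (fg x).
rewrite -[leRHS]mul1e; apply: Lpnorm_le_scale => //; rewrite powR1 mul1e.
apply: ge0_le_integral => //.
- by move=> t _; rewrite lee_fin powR_ge0.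
- by apply/measurable_EFinP; exact: (measurableT_comp (measurable_powR p) mf).
- by apply/measurable_EFinP; exact: (measurableT_comp (measurable_powR p) mg).
- by move=> t _; rewrite lee_fin ge0_ler_powR ?nnegrE ?(ltW p0).
Qed.

Lemma LpnormZ_le (c : R) (g : 'rV[R]_n -> R) :
  measurable_fun [set: n.-tuple (measurableTypeR R)] (fun t => g (rv t)) ->
  0 <= c -> (forall x, 0 <= g x) ->
  (Lpnorm p (fun x => (c * g x)%R) <= c%:E * Lpnorm p g)%E.
Proof.
move=> mg c0 g0; apply: Lpnorm_le_scale => // [x|]; first exact: mulr_ge0.
under eq_integral do rewrite powRM// EFinM.
have mgp : measurable_fun [set: n.-tuple (measurableTypeR R)] (fun t => (g (rv t) `^ p)%:E).
  by apply/measurable_EFinP; exact: (measurableT_comp (measurable_powR p) mg).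
rewrite ge0_integralZl//.
- by move=> t _; rewrite lee_fin powR_ge0.
- by rewrite lee_fin powR_ge0.
Qed.

Lemma integral_continuous_gt0 (g : 'rV[R]_n -> R) x0 : continuous g ->
  (forall x, 0 <= g x) -> 0 < g x0 -> (0 < \int[mu]_t (g (rv t))%:E)%E.
Proof.
move=> cg g0 gx0.
have h2 : g x0 / 2 < g x0 by rewrite ltr_pdivrMr// ltr_pMr// ltr1n.
have /nbhs_ballP[e /= e0 he] : \forall x \near x0, g x0 / 2 < g x by exact: (cvgr_gt _ (cg x0)).
pose A (i : 'I_n) : set (measurableTypeR R) := `[x0 0 i - e / 2, x0 0 i + e / 2]%classic.
have mA i : measurable (A i) by exact: measurable_itv.
pose Q := [set t : n.-tuple (measurableTypeR R) | forall i, A i (tnth t i)].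
have mQ : measurable Q.
  rewrite (_ : Q = \bigcap_(i in [set: 'I_n])
      ((fun t : n.-tuple (measurableTypeR R) => tnth t i) @^-1` A i)); last first.
    by apply/seteqP; split => t At i; [move=> _; exact: At|exact: (At i I)].
  apply: fin_bigcap_measurable => // i _; rewrite -[X in measurable X]setTI.
  exact: measurable_tnth.
have Qg t : Q t -> g x0 / 2 <= g (rv t).
  move=> Qt; apply/ltW/he; rewrite mx_norm_ball /ball_/=.
  apply: (@le_lt_trans _ _ (e / 2)); last by rewrite ltr_pdivrMr// ltr_pMr// ltr1n.
  rewrite rV_norm_le ?divr_ge0 ?(ltW e0)//; apply/forallP => i; rewrite !mxE.
  have := Qt i; rewrite /A/= in_itv/= => /andP[h3 h4].
  by rewrite ler_norml; apply/andP; split; lra.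
have muQ : (0 < mu Q)%E.
  rewrite /Q lebesgue_tupleE//; elim/big_ind : _ => // [x y|i _]; first exact: mule_gt0.
  rewrite lebesgue_measure_itv/= lte_fin ifT.
    by rewrite -EFinB lte_fin; lra.
  by rewrite ltrD2l gtrN// divr_gt0.
apply: (@lt_le_trans _ _ (\int[mu]_t ((g x0 / 2)%:E * (\1_Q t)%:E))%E).
  rewrite ge0_integralZl//.
  - by rewrite integral_indic// setIT mule_gt0// lte_fin divr_gt0.
  - by apply/measurable_EFinP; exact: measurable_indic.
  - by rewrite lee_fin divr_ge0.
apply: ge0_le_integral => //.
- by move=> t _; rewrite -EFinM lee_fin mulr_ge0 ?divr_ge0.
- by apply: emeasurable_funM => //; apply/measurable_EFinP; exact: measurable_indic.
- by apply/measurable_EFinP; exact: continuous_measurable_tuple.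
- move=> t _; rewrite -EFinM lee_fin indicE; have [Qt|nQ] := pselect (Q t).
    by rewrite (mem_set Qt) mulr1; exact: Qg.
  by rewrite (memNset nQ) mulr0.
Qed.

End LpTools.

Section Sharpness.
Context {R : realType} {N : nat} {Ns : seq nat} (G : stratifiedGroup R N Ns).
Notation V := 'rV[R]_(N + sumn Ns).
Notation dil := (@dilation R N Ns).
Notation tupR := ((N + sumn Ns).-tuple (measurableTypeR R)).
Notation mu := (lebesgue_tuple R (N + sumn Ns)).
Notation rv := (@rV_of_tuple R (N + sumn Ns)).

Lemma near_extremal_box_weight (p T : R) : 1 < p -> 1 <= T -> forall x : V,
  (critical_weight p x * (near_extremal_box T x)%:R) `^ p =
  shell_weight (T * expR (3 / 2 * T))^-1 (expR (- (3 * T))) (expR (3 * T)) 3 x.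
Proof.
move=> p1 T1 x; have p0 : 0 < p by rewrite (lt_trans _ p1).
rewrite powRM ?powR_ge0// /shell_weight /critical_weight -powRrM.
congr (_ `^ _ * _); first by field; rewrite gt_eqF.
have -> : shell (T * expR (3 / 2 * T))^-1 (expR (- (3 * T))) (expR (3 * T)) 3 x =
  near_extremal_box T x by [].
by case: near_extremal_box; rewrite ?mulr1n ?mulr0n ?powR1// powR0// gt_eqF.
Qed.

(** All the bumps are evaluated in [-1/3, 1/3], where they are at least exp(-3). *)
Lemma near_extremal_lower (p T : R) : 1 < p -> 1 <= T -> forall x : V,
  shell_weight (T * expR (3 / 2 * T))^-1 (expR (- T)) (expR T) 1 x <=
  (expR 3 ^+ (sumn Ns).+1) `^ p *
    cmod (hardy_quotient (near_extremal p T) x) `^ p.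
Proof.
move=> p1 T1 x; have p0 : 0 < p by rewrite (lt_trans _ p1).
have T0 : 0 < T by exact: lt_le_trans T1.
rewrite /shell_weight.
set l := (T * _)^-1.
have [/andP[/andP[q1 q2] /forallP h]|_] := boolP (shell _ _ _ _ _); last first.
  by rewrite mulr0 mulr_ge0 ?powR_ge0.
have q0 : 0 < hsq x by exact: lt_le_trans (expR_gt0 _) q1.
rewrite near_extremal_modulus// -powRM ?exprn_ge0 ?expR_ge0//; last first.
  by apply: mulr_ge0; [exact: powR_ge0|apply: mulr_ge0; [exact: bump_ge0|exact: layer_cutoff_ge0]].
have -> : hsq x `^ (- (N%:R / 2)) * true%:R = critical_weight p x `^ p.
  rewrite mulr1 /critical_weight -powRrM.
  by congr (_ `^ _); field; rewrite gt_eqF.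
rewrite ge0_ler_powR ?nnegrE ?(ltW p0) ?powR_ge0//.
  apply: mulr_ge0; first by rewrite exprn_ge0 ?expR_ge0.
  by apply: mulr_ge0; [exact: powR_ge0|apply: mulr_ge0; [exact: bump_ge0|exact: layer_cutoff_ge0]].
rewrite mulrCA ler_peMr ?powR_ge0// exprS mulrACA.
have ebump s : `|s| <= 3^-1 -> 1 <= expR 3 * bump s.
  by move=> /bump_ge h3; rewrite -ler_pdivrMl ?expR_gt0// mulr1 -expRN.
apply: mulr_ege1.
  apply: ebump; rewrite normrM ger0_norm ?invr_ge0 ?mulr_ge0 ?(ltW T0)//.
  rewrite invfM -mulrA ler_piMr ?invr_ge0// mulrC ler_pdivrMr// mul1r.
  rewrite ler_norml -{1}(expRK (- T)) -{2}(expRK T).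
  by rewrite !ler_ln ?posrE ?expR_gt0 ?q1.
have -> : expR 3 ^+ sumn Ns * layer_cutoff l x =
    \prod_(j < sumn Ns) (expR 3 * bump (dil l x 0 (rshift N j) / 3)).
  by rewrite big_split/= prodr_const card_ord.
have h1 : \prod_(j < sumn Ns) (1 : R) <=
    \prod_(j < sumn Ns) (expR 3 * bump (dil l x 0 (rshift N j) / 3)).
  apply: ler_prod => j _; rewrite ler01/=; apply: ebump.
  by rewrite normrM [X in _ * X]ger0_norm ?invr_ge0// ler_piMl ?invr_ge0//; exact: h.
by rewrite big1_eq in h1.
Qed.

(** The error term of near_extremal_hgrad has norm at most (K + A) D / T times that of
    F, where D compares the mass of the whole support of the cutoffs with the part
    where they are bounded below and does not depend on T. *)
Lemma hardy_sharp (p e : R) : 1 < p -> 0 < e -> exists f : V -> R[i],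
  [/\ test_function (@first_stratum_neq0 R N Ns) f,
      (0 < Lpnorm p (fun x => cmod (hardy_quotient f x)))%E,
      (Lpnorm p (fun x => cmod (hardy_quotient f x)) < +oo)%E &
      (Lpnorm p (fun x => cenorm (hgrad G f x)) <=
       (`|N%:R - p| / p + e)%:E * Lpnorm p (fun x => cmod (hardy_quotient f x)))%E].
Proof.
move=> p1 e0; have p0 : 0 < p by rewrite (lt_trans _ p1).
have [K K0 bK] := bump_derive_bounded (R := R).
have [A A0 cA] := layer_cutoff_hgrad_bound G.
pose E := expR (3 : R) ^+ (sumn Ns).+1.
have E0 : 0 < E by rewrite exprn_gt0// expR_gt0.
pose D : R := (3 * 3 ^+ sumn Ns) `^ p^-1 * E.
have D0 : 0 <= D by rewrite mulr_ge0 ?powR_ge0 ?(ltW E0).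
(* This makes the relative error (K + A) D / T at most e. *)
pose T := 1 + (K + A) * D / e.
have T1 : 1 <= T by rewrite lerDl divr_ge0 ?(ltW e0)// mulr_ge0// addr_ge0 ?(ltW K0) ?(ltW A0).
have T0 : 0 < T by exact: lt_le_trans T1.
pose f : V -> R[i] := near_extremal p T.
have tf : test_function (@first_stratum_neq0 R N Ns) f by exact: near_extremal_test.
have [_ mF mB cF Foo] := test_function_hardy_integral G p f p1 tf.
pose F x := cmod (hardy_quotient f x).
have F0 x : 0 <= F x by exact: cmod_ge0.
pose w (x : V) : R := critical_weight p x * (near_extremal_box T x)%:R.
have w0 x : 0 <= w x by rewrite mulr_ge0// powR_ge0.
have mw : measurable_fun [set: tupR] (fun t => w (rv t)).
  apply: measurable_funM; last exact: measurable_shell.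
  apply: (measurableT_comp (measurable_powR _)).
  exact: (continuous_measurable_tuple _ hsq (Ck_continuous 0%N _ (Ck_hsq 0%N))).
exists f; split => //.
- rewrite LpnormE// poweR_gt0//.
  have N0 : (0 < N)%N by have /andP[] := sg_strata_gt0 G.
  (* At this point ln |x'|^2 and the higher coordinates are 0: all bumps are positive. *)
  pose x0 : V := delta_mx 0 (lshift (sumn Ns) (Ordinal N0)).
  apply: (integral_continuous_gt0 _ _ x0 cF) => [x|]; first exact: powR_ge0.
  have q1 : hsq x0 = 1.
    rewrite /hsq (bigD1 (Ordinal N0))//= big1 => [|k kn].
      by rewrite mxE !eqxx expr1n addr0.
    by rewrite mxE eqxx/= (inj_eq (@lshift_inj _ _)) (negbTE kn) expr0n.
  have b0 : 0 < bump (0 : R).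
    by apply: lt_le_trans (bump_ge 0 _); rewrite ?expR_gt0// normr0 invr_ge0.
  rewrite powR_gt0// near_extremal_modulus ?q1// ln1 mulr0.
  apply: mulr_gt0; first by rewrite /critical_weight q1 powR1.
  apply: mulr_gt0 => //; apply: prodr_gt0 => j _.
  by rewrite !mxE/= eq_rlshift mulr0 mul0r.
- by rewrite LpnormE//; apply: poweR_lty.
have Nw : (Lpnorm p w <= D%:E * Lpnorm p F)%E.
  apply: Lpnorm_le_scale => //.
  under eq_integral do rewrite near_extremal_box_weight//.
  apply: (le_trans (shell_weight_covering _ T T0)).
  have -> : D `^ p = 3 * 3 ^+ sumn Ns * E `^ p.
    rewrite powRM ?powR_ge0 ?(ltW E0)// -powRrM mulVf ?gt_eqF// powRr1//.
  rewrite (EFinM (3 * _)) -(muleA (3 * _)%:E).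
  apply: lee_wpmul2l; first by rewrite lee_fin mulr_ge0 ?exprn_ge0.
  have mFp : measurable_fun [set: tupR] (fun t => (F (rv t) `^ p)%:E).
    by apply/measurable_EFinP; exact: (measurableT_comp (measurable_powR p) mF).
  rewrite -ge0_integralZl//; last 2 first.
  - by move=> t _; rewrite lee_fin powR_ge0.
  - by rewrite lee_fin powR_ge0.
  apply: ge0_le_integral => //.
  - by move=> t _; rewrite lee_fin shell_weight_ge0.
  - by apply/measurable_EFinP; exact: measurable_shell_weight.
  - exact: measurable_funeM.
  - by move=> t _; rewrite -EFinM lee_fin; exact: near_extremal_lower.
set c := `|_| / p.
have c0 : 0 <= c by rewrite divr_ge0// ltW.
have KT0 : 0 <= (K + A) / T by rewrite divr_ge0 ?(ltW T0)// addr_ge0 ?(ltW K0) ?(ltW A0).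
have KAD : (K + A) / T * D <= e.
  have eT : e * T = e + (K + A) * D by rewrite /T; field; rewrite gt_eqF.
  by rewrite mulrAC ler_pdivrMr// eT lerDr ltW.
apply: (@le_trans _ _ (Lpnorm p (fun x => c * F x + (K + A) / T * w x)%R)).
  apply: Lpnorm_le => //.
  - by apply: measurable_funD; apply: measurable_funM.
  - by move=> x; exact: sqrtr_ge0.
  - by move=> x; exact: near_extremal_hgrad.
have := @minkowski_EFin _ _ _ mu (fun t => c * F (rv t)) (fun t => (K + A) / T * w (rv t)) p.
move=> /(_ _ _ (ltW p1)) H.
apply: (le_trans (H _ _)).
- exact: measurable_funM.
- exact: measurable_funM.
rewrite EFinD ge0_muleDl ?lee_fin ?(ltW e0)// leeD//.
  exact: LpnormZ_le.
apply: (le_trans (LpnormZ_le _ _ p0 ((K + A) / T) w mw KT0 w0)).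
apply: (@le_trans _ _ (((K + A) / T)%:E * (D%:E * Lpnorm p F))%E).
  by rewrite lee_wpmul2l// lee_fin.
rewrite muleA -EFinM lee_wpmul2r ?lee_fin//.
exact: Lnorm_ge0.
Qed.

End Sharpness.

Theorem mainTheorem2 (R : realType) (N : nat) (Ns : seq nat)
    (G : stratifiedGroup R N Ns) (p : R) (hp : 1 < p) :
  [/\ (forall f : 'rV[R]_(N + sumn Ns) -> R[i],
         test_function (@first_stratum_neq0 R N Ns) f ->
         ((`|N%:R - p| / p)%:E * Lpnorm p (fun x => cmod (hardy_quotient f x))
            <= Lpnorm p (fun x => cenorm (hgrad G f x)))%E),
      (p != N%:R -> forall C : R,
         (forall f : 'rV[R]_(N + sumn Ns) -> R[i],
            test_function (@first_stratum_neq0 R N Ns) f ->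
            (C%:E * Lpnorm p (fun x => cmod (hardy_quotient f x))
               <= Lpnorm p (fun x => cenorm (hgrad G f x)))%E) ->
         C <= `|N%:R - p| / p)
    & (p < N%:R ->
         (forall f : 'rV[R]_(N + sumn Ns) -> R[i],
            test_function (@first_stratum_neq0 R N Ns) f ->
            (Lpnorm p (fun x => cmod (hardy_quotient f x))
               <= (p / (N%:R - p))%:E * Lpnorm p (fun x => cenorm (hgrad G f x)))%E) /\
         (forall C : R,
            (forall f : 'rV[R]_(N + sumn Ns) -> R[i],
               test_function (@first_stratum_neq0 R N Ns) f ->
               (Lpnorm p (fun x => cmod (hardy_quotient f x))
                  <= C%:E * Lpnorm p (fun x => cenorm (hgrad G f x)))%E) ->
            p / (N%:R - p) <= C))].
Proof.
have p0 : 0 < p by rewrite (lt_trans _ hp).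
have sharp (C : R) : (forall f : 'rV[R]_(N + sumn Ns) -> R[i],
      test_function (@first_stratum_neq0 R N Ns) f ->
      (C%:E * Lpnorm p (fun x => cmod (hardy_quotient f x))
         <= Lpnorm p (fun x => cenorm (hgrad G f x)))%E) ->
    C <= `|N%:R - p| / p.
  move=> hC; apply/ler_addgt0Pr => e e0.
  have [f [tf F0 Foo h]] := hardy_sharp G p e hp e0.
  have := le_trans (hC f tf) h.
  by rewrite lee_pmul2r// ge0_fin_numE// ltW.
split; first by move=> f; exact: hardy_inequality.
  by move=> _; exact: sharp.
move=> pN; have Np0 : 0 < N%:R - p by rewrite subr_gt0.
have cE : `|N%:R - p| / p = (p / (N%:R - p))^-1 by rewrite gtr0_norm// invf_div.
have d0 : 0 < p / (N%:R - p) by rewrite divr_gt0.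
split => [f tf|C hC].
  have := hardy_inequality G p f hp tf; rewrite cE.
  by rewrite -lee_pdivlMl ?invr_gt0// invrK.
(* A constant C <= 0 would force the left-hand sides to vanish. *)
have C0 : 0 < C.
  rewrite ltNge; apply/negP => C0.
  have [f [tf F0 _ _]] := hardy_sharp G p 1 hp ltr01.
  have := lt_le_trans F0 (hC f tf); rewrite ltNge => /negP; apply.
  by rewrite mule_le0_ge0 ?lee_fin//; exact: Lnorm_ge0.
rewrite -(invrK C) -[leLHS]invrK lef_pV2 ?posrE ?invr_gt0//.
rewrite -cE; apply: sharp => f tf.
by rewrite lee_pdivrMl//; exact: hC.
Qed.
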